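(* Let $h$ be a measuring function such that the relation $\frac{1}{|\log r|}=O(h(r))$ as $r\to 0+$ does not hold. Then there exists a dense $G_\delta$-subset $S\subset[0,1]$ with $m_h(S)=0$ and full capacity $\mathrm{Cap}(S)=\mathrm{Cap}([0,1])$.
   Context: For a compactly supported Borel measure $\mu$ on $\mathbb{C}$, its energy is $I(\mu):=\iint -\log|z-w|\,d\mu(z)\,d\mu(w)$ (possibly $+\infty$). For a bounded Borel set $X\subset\mathbb{C}$, let $\mathcal{P}(X)$ be the set of Borel probability measures supported on $X$ (i.e. $\mu(\mathbb{C}\setminus X)=0$); the logarithmic capacity of $X$ is $\mathrm{Cap}(X):=\exp(-\inf\{I(\mu)\mid \mu\in\mathcal{P}(X)\})$, with $\exp(-\infty)=0$. A measuring function is a continuous increasing function $h$, defined and positive in some right neighborhood $(0,r_* )$ of $0$. For $E\subset\mathbb{R}$ its $h$-volume is $$m_h(E):=\lim_{\varepsilon\to 0+}\ \inf \sum_{j} h(r_j),$$ where the infimum is over all countable covers of $E$ by balls (intervals) $U_{r_j}(x_j)$, with center $x_j$ and diameter $r_j>0$, such that $r_j<\varepsilon$ for all $j$. *)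

(* Defs.v *)
From mathcomp Require Import all_boot all_order all_algebra.
From mathcomp Require Import all_classical all_reals all_analysis.
From mathcomp Require Import complex.

Set Implicit Arguments.
Unset Strict Implicit.
Unset Printing Implicit Defensive.

Import Order.TTheory GRing.Theory Num.Theory.
Import numFieldNormedType.Exports.
Local Open Scope classical_set_scope.
Local Open Scope ring_scope.
Local Open Scope complex_scope.

(* [R[i]] carries no measurable structure in the library; here it gets the
   Borel sigma-algebra of its norm topology. *)
Definition borelC (R : realType) :=
  g_sigma_algebraType (@open (R[i] : numFieldType)).

(* [lne 0 = -oo], so the kernel is [+oo] on the diagonal. *)
Definition energy (R : realType) (mu : probability (borelC R) R) : \bar R :=
  (\int[mu]_z \int[mu]_w (- lne (Normc.normc ((z : R[i]) - (w : R[i])))%:E))%E.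

Definition prob_on (R : realType) (X : set R[i]) :
    set (probability (borelC R) R) :=
  [set mu : probability (borelC R) R | mu (~` (X : set (borelC R))) = 0%E].

(* Meant for bounded Borel [X]; the infimum over the empty set is [+oo]. *)
Definition Cap (R : realType) (X : set R[i]) : \bar R :=
  expeR (- ereal_inf [set energy mu | mu in prob_on X])%E.

Definition embC (R : realType) (E : set R) : set R[i] :=
  [set x%:C | x in E].

(* [h] is total, but only its values on some ]0, rstar[ are constrained, and
   only its germ at 0+ matters for [h_volume]; "increasing" is non-strict. *)
Definition measuring_function (R : realType) (h : R -> R) : Prop :=
  exists2 rstar : R, 0 < rstar &
    [/\ forall r, r \in `]0, rstar[ -> 0 < h r,
        {in `]0, rstar[ &, {homo h : x y / x <= y}} &
        {in `]0, rstar[, continuous h}].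

(* The index set [D] of a cover may be finite or infinite; [r j] is the
   diameter of the [j]-th ball, not its radius. *)
Definition is_cover (R : realType) (E : set R) (eps : R)
    (D : set nat) (x r : nat -> R) : Prop :=
  (forall j, D j -> 0 < r j < eps) /\
  E `<=` \bigcup_(j in D) ball (x j) (r j / 2).

Definition h_content (R : realType) (h : R -> R) (E : set R) (eps : R) :
    \bar R :=
  ereal_inf [set s | exists (D : set nat) (x r : nat -> R),
    is_cover E eps D x r /\ s = (\esum_(j in D) (h (r j))%:E)%E].

Definition h_volume (R : realType) (h : R -> R) (E : set R) : \bar R :=
  lim (h_content h E eps @[eps --> 0^'+]).

(* Main.v *)
From HB Require Import structures.
Require Import Defs.
From mathcomp Require Import all_boot all_order all_algebra.
From mathcomp Require Import all_classical all_reals all_analysis.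
From mathcomp Require Import borel_hierarchy measurable_realfun complex.
From mathcomp Require Import ring lra.

Set Implicit Arguments.
Unset Strict Implicit.
Unset Printing Implicit Defensive.

Import Order.TTheory GRing.Theory Num.Theory.
Import numFieldNormedType.Exports.
Local Open Scope classical_set_scope.
Local Open Scope ring_scope.

(** Why the theorem holds.

    Since [1 / |ln r|] is not [O(h r)], there are scales [r_m -> 0] and powers
    of two [N_m = 2 ^ a_m] such that [N_m * h r_m] is summable while
    [|ln r_m| / N_m -> 0] ([exists_scale]). Let [U_m] be the union of the
    intervals of length [r_m] centered at the points [k / N_m] of [0, 1], and
    let [S] be the upper limit of the sets [U_m] ([limsup_grid]). It is a
    [G_delta], it contains all the dyadic points of [0, 1], and it lies in
    [0, 1] because [r_m -> 0]. The intervals of the [U_m] with [m >= n] cover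
    it at a total cost bounded by the tail of a convergent series, so its
    [h]-volume vanishes.

    For the capacity one has to find, for each probability [mu] on [0, 1] of
    finite energy, a probability on [S] whose energy is not much larger. All
    probabilities are presented as laws of real random variables [X], so that
    an energy is a double integral of a function of [X w - X w'] over the
    product of the probability space with itself ([diffint]).

    - Blurring. Replacing [mu] by the law of [(1 - eta) Y + eta V], with [Y] of
      law [mu] and [V] uniform and independent of [Y], costs an arbitrarily
      small amount of energy ([diffint_blur]) and makes the probability of
      [|X w - X w'| < s] at most [M * s] for some [M] ([spread_blur]).
    - Squeezing. Cut the line into the cells of length [1 / N] centered at the
      points [k / N] and contract each of them towards its center by a factor
      [rho] ([squeeze]). Two points of one cell get closer by the factor [rho],
      which costs [- ln rho] on an event of probability at most [M / N]; the
      points of distinct cells keep their distance up to a factor [4], and up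
      to a factor close to [1] if they are far apart compared with [1 / N].
      When [N] is [N_m] and the cells become half as long as the intervals of
      [U_m], the total cost tends to [0] as [m] grows ([near_squeeze_energy]).
      The new variable again satisfies a bound of the form [M * s], with a
      larger [M], because a squeeze multiplies all distances by at least
      [min (rho, 1/4)] ([spread_expand]).
    - Iteration. Squeezing along a sparse sequence of scales moves each value
      by a summable amount, so the variables converge uniformly, to a limit
      which remains in [U_m] for each scale [m] used; hence the limit takes its
      values in [S]. As the kernel is nonnegative and continuous with values in
      the extended reals, Fatou's lemma bounds the energy of the limit
      ([redistribution]). *)

(** * Powers of one half *)

Section half_powers.
Context {R : realType}.

Lemma cvg_half_expr : (fun n => (2^-1 : R) ^+ n) @ \oo --> (0 : R).
Proof. by apply: cvg_expr; rewrite gtr0_norm ?invr_gt0// invf_lt1// ltr1n. Qed.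

Lemma exists_half_expr (e : R) : 0 < e -> exists n, 2^-1 ^+ n < e.
Proof.
move=> e0; move/cvgrPdist_lt : cvg_half_expr => /(_ _ e0) /filter_ex[n].
by rewrite sub0r normrN gtr0_norm ?exprn_gt0 ?invr_gt0//; exists n.
Qed.

Lemma half_expr_le (m n : nat) : (m <= n)%N -> 2^-1 ^+ n <= 2^-1 ^+ m :> R.
Proof.
by move=> mn; apply: ler_wiXn2l => //; rewrite ?invr_ge0// invf_le1// ler1n.
Qed.

End half_powers.

(** * The logarithmic kernel *)

Section logker.
Context {R : realType}.
Implicit Types c d t x y : R.

(** [- ln |d|] truncated at distance [1]. On [0, 1] this is the kernel of the
    energy; the truncation makes it nonnegative on the whole line, which gives
    access to Tonelli's theorem and to Fatou's lemma. *)
Definition logker d : \bar R := (- lne (Num.min `|d| 1)%:E)%E.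

Lemma logker0 : logker 0 = +oo%E.
Proof. by rewrite /logker normr0 min_l//= lexx. Qed.

Lemma logkerE d : d != 0 -> logker d = (- ln (Num.min `|d| 1))%:E.
Proof.
move=> d0; rewrite /logker lne_EFin; first by rewrite EFinN.
by rewrite lt_min normr_gt0 d0 ltr01.
Qed.

Lemma logker_ge0 d : (0 <= logker d)%E.
Proof.
have [->|d0] := eqVneq d 0; first by rewrite logker0 leey.
by rewrite logkerE// lee_fin oppr_ge0 ln_le0// ge_min lexx orbT.
Qed.

(** Every energy estimate below goes through this comparison: contracting a
    distance by a factor [c] costs at most [- ln c]. *)
Lemma le_logker c d d' : 0 < c <= 1 -> c * `|d| <= `|d'| ->
  (logker d' <= logker d + (- ln c)%:E)%E.
Proof.
move=> /andP[c0 c1] cdd'.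
have [->|d0] := eqVneq d 0; first by rewrite logker0 addye// leey.
have nd0 : 0 < `|d| by rewrite normr_gt0.
have nd'0 : 0 < `|d'| by apply: lt_le_trans cdd'; rewrite mulr_gt0.
have m0 : 0 < Num.min `|d| 1 by rewrite lt_min nd0 ltr01.
rewrite !logkerE ?d0//; last by rewrite -normr_gt0.
rewrite -EFinD lee_fin -opprD lerN2 -lnM ?posrE//.
rewrite ler_ln ?posrE ?mulr_gt0//; last by rewrite lt_min nd'0 ltr01.
rewrite le_min; apply/andP; split.
  apply: le_trans cdd'; rewrite mulrC; apply: ler_wpM2l; first exact: ltW.
  by rewrite ge_min lexx.
have : Num.min `|d| 1 <= 1 by rewrite ge_min lexx orbT.
nra.
Qed.

Lemma logker_lb t d : 0 < t <= 1 -> `|d| < t -> ((- ln t)%:E <= logker d)%E.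
Proof.
move=> /andP[t0 t1] dt; have [->|d0] := eqVneq d 0; first by rewrite logker0 leey.
rewrite logkerE// lee_fin lerN2 ler_ln ?posrE//.
  by rewrite ge_min (ltW dt).
by rewrite lt_min normr_gt0 d0 ltr01.
Qed.

Lemma measurable_logker : measurable_fun setT logker.
Proof.
rewrite (_ : logker = fun d => if d == 0 then +oo%E
    else (- ln (Num.min `|d| 1))%:E); last first.
  apply/funext => d; case: ifPn => [/eqP ->|]; first exact: logker0.
  exact: logkerE.
apply: measurable_fun_ifT => //.
  exact: measurable_fun_eqr.
apply/measurable_EFinP; apply/measurable_funN.
apply: measurableT_comp; first exact: measurable_ln.
by apply: measurable_minr.
Qed.

(** The kernel is continuous up to and including the diagonal, where its value
    is [+oo]; this is what Fatou's lemma needs for a limit of variables. *)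
Lemma logker_cvg (u : R^nat) d : u @ \oo --> d ->
  (logker \o u) @ \oo --> logker d.
Proof.
move=> ud; have [d0|d0] := eqVneq d 0.
  rewrite d0 logker0; apply/cvgeyPge => M.
  have e0 : 0 < expR (- `|M|) :> R by exact: expR_gt0.
  move/cvgrPdist_lt : ud => /(_ _ e0); apply: filterS => n.
  rewrite d0 sub0r normrN /= => un.
  have e01 : 0 < expR (- `|M|) <= 1 by rewrite e0 -expR0 ler_expR oppr_le0 normr_ge0.
  have := logker_lb e01 un.
  by rewrite expRK opprK; apply: le_trans; rewrite lee_fin ler_norm.
rewrite logkerE//.
have m0 : 0 < Num.min `|d| 1 by rewrite lt_min normr_gt0 d0 ltr01.
have cv : (fun n => (- ln (Num.min `|u n| 1))%:E) @ \oo
    --> (- ln (Num.min `|d| 1))%:E.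
  apply: cvg_EFin; first exact: nearW.
  apply: cvgN; apply: continuous_cvg; first exact: continuous_ln.
  have cm : {for d, continuous (fun x : R => Num.min `|x| 1)}.
    by apply: continuous_min; [exact: norm_continuous|exact: cvg_cst].
  by move: ud cm; exact: cvg_comp.
apply: cvg_trans cv; apply: near_eq_cvg.
have : \forall n \near \oo, u n != 0.
  have nd0 : 0 < `|d| by rewrite normr_gt0.
  move/cvgrPdist_lt : ud => /(_ _ nd0); apply: filterS => n; apply: contraTneq => ->.
  by rewrite subr0 ltxx.
by apply: filterS => n un0; rewrite /= logkerE.
Qed.

End logker.

(** * Squeezing the cells of a grid *)

Section squeeze.
Context {R : realType}.
Implicit Types q rho x y : R.

(** The integer nearest to [q * x], so that the cells are centered at the
    points of the grid and those that meet [0, 1] have their center in it. *)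
Definition cell q x : R := (Num.floor (q * x + 1 / 2))%:~R.

Definition squeeze q rho x := cell q x / q + rho * (x - cell q x / q).

Lemma cell_itv q x : - (1/2) <= q * x - cell q x < 1 / 2.
Proof.
have /andP[] := floor_itv (q * x + 1 / 2).
rewrite -/(cell q x) intrD1 => H1 H2.
by apply/andP; split; rewrite ?lerBrDr ?ltrBlDr; lra.
Qed.

Lemma cell_gap q x y : cell q x < cell q y -> cell q x + 1 <= cell q y.
Proof. by rewrite /cell ltr_int -lezD1 -(ler_int R) intrD1. Qed.

Lemma squeeze_same q rho x y : cell q x = cell q y ->
  squeeze q rho x - squeeze q rho y = rho * (x - y).
Proof. by rewrite /squeeze => ->; ring. Qed.

Lemma cell_same_dist q x y : 0 < q -> cell q x = cell q y -> `|x - y| < q^-1.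
Proof.
move=> q0 xy; rewrite -[ltRHS]mul1r ltr_pdivlMr// -{1}(gtr0_norm q0) -normrM.
have /andP[x1 x2] := cell_itv q x.
have /andP[y1 y2] := cell_itv q y.
by rewrite ltr_norml; apply/andP; split; nra.
Qed.

Lemma squeeze_move q rho x : 0 < q -> 0 < rho <= 1/2 ->
  `|squeeze q rho x - x| <= (2 * q)^-1.
Proof.
move=> q0 /andP[r0 r1].
have /andP[x1 x2] := cell_itv q x.
have -> : squeeze q rho x - x = (rho - 1) * (q * x - cell q x) / q.
  by rewrite /squeeze; field; rewrite gt_eqF.
rewrite invfM normrM [`|q^-1|]gtr0_norm ?invr_gt0// ler_pM2r ?invr_gt0//.
by rewrite ler_norml; apply/andP; split; nra.
Qed.

Lemma squeeze_center q rho x : 0 < q -> 0 < rho ->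
  `|squeeze q rho x - cell q x / q| <= rho / (2 * q).
Proof.
move=> q0 r0; have /andP[x1 x2] := cell_itv q x.
have -> : squeeze q rho x - cell q x / q = rho * (q * x - cell q x) / q.
  by rewrite /squeeze; field; rewrite gt_eqF.
rewrite normrM [`|q^-1|]gtr0_norm ?invr_gt0// invfM mulrA ler_pM2r ?invr_gt0//.
by rewrite ler_norml; apply/andP; split; nra.
Qed.

Lemma squeeze_gap q rho x y : 0 < q -> 0 < rho <= 1/2 -> cell q x < cell q y ->
  y - x <= 4 * (squeeze q rho y - squeeze q rho x) /\
  y - x - q^-1 <= squeeze q rho y - squeeze q rho x.
Proof.
move=> q0 /andP[r0 r1] /cell_gap xy.
have /andP[x1 x2] := cell_itv q x.
have /andP[y1 y2] := cell_itv q y.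
set D := cell q y - cell q x.
set w := (q * y - cell q y) - (q * x - cell q x).
have -> : y - x = (D + w) / q by rewrite /D /w; field; rewrite gt_eqF.
have -> : squeeze q rho y - squeeze q rho x = (D + rho * w) / q.
  by rewrite /D /w /squeeze; field; rewrite gt_eqF.
have D1 : 1 <= D by rewrite /D lerBrDl.
have [w1 w2] : -1 <= w /\ w <= 1 by rewrite /w; split; lra.
split.
  by rewrite mulrA ler_pM2r ?invr_gt0//; nra.
by rewrite -{2}[q^-1]mul1r -mulrBl ler_pM2r ?invr_gt0//; nra.
Qed.

(** Both bounds are needed: the first one covers neighbouring cells, where only
    the ratio of the distances is controlled, and the second one is sharp for
    points which are far apart on the scale [q^-1]. *)
Lemma squeeze_far q rho x y : 0 < q -> 0 < rho <= 1/2 -> cell q x != cell q y ->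
  `|x - y| / 4 <= `|squeeze q rho x - squeeze q rho y| /\
  `|x - y| - q^-1 <= `|squeeze q rho x - squeeze q rho y|.
Proof.
move=> q0 rho12; wlog xy : x y / cell q x < cell q y => [H|_].
  rewrite neq_lt => /orP[|] xy; first by apply: H => //; rewrite lt_eqF.
  rewrite distrC [`|squeeze _ _ _ - _|]distrC.
  by apply: H => //; rewrite lt_eqF.
have [H1 H2] := squeeze_gap q0 rho12 xy.
have yx : x < y.
  have := xy; rewrite /cell ltr_int => fl; rewrite ltNge; apply/negP => yx.
  move: fl; rewrite ltNge => /negP; apply; apply: le_floor.
  by rewrite lerD2r ler_pM2l.
rewrite distrC [`|squeeze _ _ _ - _|]distrC [`|y - x|]gtr0_norm ?subr_gt0//.
have T := ler_norm (squeeze q rho y - squeeze q rho x).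
split; lra.
Qed.

Lemma squeeze_expand q rho x y : 0 < q -> 0 < rho <= 1/2 ->
  Num.min rho 4^-1 * `|x - y| <= `|squeeze q rho x - squeeze q rho y|.
Proof.
move=> q0 rho12; have /andP[r0 r1] := rho12.
have [xy|xy] := eqVneq (cell q x) (cell q y).
  rewrite squeeze_same// normrM (gtr0_norm r0) ler_wpM2r//.
  by rewrite ge_min lexx.
have [H _] := squeeze_far q0 rho12 xy.
apply: le_trans H; rewrite mulrC ler_wpM2l//.
by rewrite ge_min lexx orbT.
Qed.

Lemma squeeze_nondecreasing q rho : 0 < q -> 0 < rho <= 1/2 ->
  nondecreasing_fun (squeeze q rho).
Proof.
move=> q0 rho12 x y xy; have /andP[r0 r1] := rho12.
have : cell q x <= cell q y.
  by rewrite /cell ler_int; apply: le_floor; rewrite lerD2r ler_pM2l.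
rewrite le_eqVlt => /orP[/eqP /(@squeeze_same q rho _ _) E|E].
  by rewrite -subr_le0 E; nra.
have [H1 H2] := squeeze_gap q0 rho12 E.
lra.
Qed.

Lemma measurable_squeeze q rho : 0 < q -> 0 < rho <= 1/2 ->
  measurable_fun setT (squeeze q rho).
Proof.
by move=> q0 rho12; apply: nondecreasing_measurable => //; exact: squeeze_nondecreasing.
Qed.

Lemma cell_unit (n : nat) x : (0 < n)%N -> 0 <= x <= 1 ->
  exists2 k : nat, (k <= n)%N & cell n%:R x = k%:R.
Proof.
move=> n0 /andP[x0 x1]; have n0' : 0 < n%:R :> R by rewrite ltr0n.
have f0 : (0 <= Num.floor (n%:R * x + 1 / 2))%R.
  have : 0 <= n%:R * x + 1 / 2 by rewrite addr_ge0// mulr_ge0.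
  by move/le_floor; rewrite floor0.
exists `|Num.floor (n%:R * x + 1 / 2)|%N; last first.
  by rewrite /cell natr_absz ger0_norm.
rewrite -lez_nat gez0_abs//.
have /andP[H1 H2] := cell_itv n%:R x.
rewrite -ltzD1 -(ltr_int R) intrD1 -/(cell n%:R x).
have : n%:R * x <= n%:R by nra.
by rewrite -[X in _ < X + 1]pmulrn; lra.
Qed.

(** The endpoints are centers of cells, hence fixed, and a squeeze is
    monotone. *)
Lemma squeeze_unit (n : nat) rho x : (0 < n)%N -> 0 < rho <= 1/2 ->
  0 <= x <= 1 -> 0 <= squeeze n%:R rho x <= 1.
Proof.
move=> n0 rho12 x01; have /andP[x0 x1] := x01; have /andP[r0 r1] := rho12.
have n0' : 0 < n%:R :> R by rewrite ltr0n.
have c0 : squeeze n%:R rho 0 = 0.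
  rewrite /squeeze /cell mulr0 add0r (_ : Num.floor _ = 0) ?mul0r ?subr0 ?mulr0 ?addr0//.
  apply/eqP; rewrite floor_eq; lra.
have c1 : squeeze n%:R rho 1 = 1.
  rewrite /squeeze /cell mulr1 (_ : Num.floor _ = n%:Z).
    by rewrite -pmulrn divff ?gt_eqF//; ring.
  apply/eqP; rewrite floor_eq intrD1 -pmulrn; lra.
have := squeeze_nondecreasing n0' rho12 x0; rewrite c0 => ->/=.
by have := squeeze_nondecreasing n0' rho12 x1; rewrite c1.
Qed.

End squeeze.

(** * Energy of a random variable and the cost of a squeeze *)

Lemma mem_ball0 (R : realType) (s x : R) : (x \in (ball (0 : R) s : set R)) = (`|x| < s).
Proof. by apply/idP/idP; rewrite inE /ball/= sub0r normrN. Qed.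

(** The three cases are: two points in one cell, which contributes the term with
    [ln rho]; distinct cells but distance less than [L], which contributes the
    term with [ln 4]; and distance at least [L], where the sharp bound of
    [squeeze_far] contributes [e]. *)
Lemma squeeze_logker (R : realType) (q rho L e x y : R) : 0 < q -> 0 < rho <= 1/2 ->
  0 < L -> 0 <= e -> expR (- e) <= 1 - (q * L)^-1 ->
  (logker (squeeze q rho x - squeeze q rho y) <= logker (x - y)
    + (e%:E + ((ln 4)%:E * (\1_(ball 0 L) (x - y))%:E
    + (- ln rho)%:E * (\1_(ball 0 q^-1) (x - y))%:E)))%E.
Proof.
move=> q0 rho12 L0 e0 eL; have /andP[r0 r1] := rho12.
have l4 : 0 <= ln 4 :> R by rewrite ln_ge0// ler1n.
have lr : 0 <= - ln rho by rewrite oppr_ge0 ln_le0//; lra.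
rewrite -!EFinM -!EFinD.
have bE (s d : R) : \1_(ball (0 : R) s) d = (`|d| < s)%R%:R :> R.
  by rewrite indicE mem_ball0.
rewrite !bE.
have [xy|xy] := eqVneq (cell q x) (cell q y).
  rewrite squeeze_same// (cell_same_dist q0 xy) mulr1.
  apply: (@le_trans _ _ (logker (x - y) + (- ln rho)%:E)%E).
    apply: le_logker; first by rewrite r0; lra.
    by rewrite normrM gtr0_norm.
  rewrite leeD2l// lee_fin addrCA addrA lerDr addrC.
  by rewrite addr_ge0// mulr_ge0.
have [far4 far1] := squeeze_far q0 rho12 xy.
have [xyL|xyL] := ltP `|x - y| L.
  apply: (@le_trans _ _ (logker (x - y) + (- ln 4^-1)%:E)%E).
    apply: le_logker; first by lra.
    by rewrite mulrC.
  rewrite leeD2l// lee_fin lnV ?posrE// opprK mulr1 addrCA lerDl.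
  by rewrite addr_ge0// mulr_ge0.
apply: (@le_trans _ _ (logker (x - y) + (- ln (expR (- e)))%:E)%E).
  apply: le_logker; first by rewrite expR_gt0 -expR0 ler_expR oppr_le0.
  apply: le_trans far1; apply: (le_trans (ler_wpM2r (normr_ge0 _) eL)).
  rewrite mulrBl mul1r lerD2l lerN2 invfM -mulrA ler_peMr//.
    by rewrite invr_ge0 ltW.
  by rewrite mulrC ler_pdivlMr// mul1r.
rewrite leeD2l// lee_fin expRK opprK lerDl addr_ge0//; exact: mulr_ge0.
Qed.

Section diffint.
Context {d} {T : measurableType d} {R : realType} (P : probability T R).
Implicit Types (X : T -> R) (f : R -> \bar R).
Local Open Scope ereal_scope.

Definition diffint X f := \int[P \x P]_p f (X p.1 - X p.2)%R.

(** Two independent copies of [X] are within distance [s] with probability at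
    most [M * s]. This holds when the law of [X] has a density bounded by
    [M / 2]; in this form it is visibly stable under maps that are
    bounded below, in the sense of [spread_expand]. *)
Definition spread X (M : R) := (0 <= M)%R /\ forall s : R, (0 < s)%R ->
  diffint X (fun d => (\1_(ball 0%R s) d)%:E) <= (M * s)%:E.

Lemma measurable_diff X f : measurable_fun setT X -> measurable_fun setT f ->
  measurable_fun setT (fun p : T * T => f (X p.1 - X p.2)%R).
Proof.
move=> mX mf; apply: (measurableT_comp mf); apply: measurable_funB => //.
- exact: (measurableT_comp mX).
- exact: (measurableT_comp mX).
Qed.

Lemma measurable_ball_indic (s : R) :
  measurable_fun setT (fun x : R => (\1_(ball 0%R s) x : R)%:E).
Proof.
by apply/measurable_EFinP; apply: measurable_indic; apply: measurable_ball.
Qed.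

Lemma diffint_iter X f : measurable_fun setT X -> measurable_fun setT f ->
  (forall d, 0 <= f d) ->
  diffint X f = \int[P]_w \int[P]_w' f (X w - X w')%R.
Proof.
move=> mX mf f0; have m2 := measurable_diff mX mf.
by rewrite /diffint fubini_tonelli1.
Qed.

Let PP1 : (P \x P) setT = 1.
Proof.
rewrite -setXTT product_measure1E//.
by apply: etrans (congr2 mule (probability_setT P) (probability_setT P)) _; exact: mule1.
Qed.

Lemma diffint_squeeze X (M q rho L e : R) : measurable_fun setT X -> spread X M ->
  (0 < q)%R -> (0 < rho <= 1/2)%R ->
  (0 < L)%R -> (0 <= e)%R -> (expR (- e) <= 1 - (q * L)^-1)%R ->
  diffint (squeeze q rho \o X) logker <= diffint X logker
    + (e + (ln 4 * (M * L) + - ln rho * (M * q^-1)))%:E.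
Proof.
move=> mX [M0 sX] q0 rho12 L0 e0 eL; have /andP[r0 r1] := rho12.
have l4 : (0 <= ln 4 :> R)%R by rewrite ln_ge0// ler1n.
have lr : (0 <= - ln rho)%R by rewrite oppr_ge0 ln_le0//; lra.
have mb s := measurable_diff mX (measurable_ball_indic s).
have mk := measurable_diff mX (@measurable_logker R).
have b0 s (x : R) : 0 <= (\1_(ball 0%R s) x : R)%:E by rewrite lee_fin.
apply: (@le_trans _ _ (\int[P \x P]_p (logker (X p.1 - X p.2)%R
    + (e%:E + ((ln 4)%:E * (\1_(ball 0%R L) (X p.1 - X p.2)%R)%:E
    + (- ln rho)%:E * (\1_(ball 0%R q^-1) (X p.1 - X p.2)%R)%:E))))).
  apply: ge0_le_integral => //.
  - by move=> p _; exact: logker_ge0.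
  - apply: (@measurable_diff (squeeze q rho \o X) logker) => //.
    + apply: measurableT_comp => //; exact: measurable_squeeze.
    + exact: measurable_logker.
  - apply: emeasurable_funD => //; apply: emeasurable_funD => //.
    by apply: emeasurable_funD => //; apply: emeasurable_funM.
  - by move=> p _; exact: squeeze_logker.
rewrite ge0_integralD//=; last first.
- apply: emeasurable_funD => //.
  by apply: emeasurable_funD => //; apply: emeasurable_funM.
- move=> p _; rewrite adde_ge0// adde_ge0// mule_ge0//; exact: b0.
- by move=> p _; exact: logker_ge0.
rewrite leeD2l// ge0_integralD//=; last first.
- by apply: emeasurable_funD => //; apply: emeasurable_funM.
- by move=> p _; rewrite adde_ge0// mule_ge0//; exact: b0.
rewrite integral_cst//= PP1 mule1 ge0_integralD//=; last first.
- by apply: emeasurable_funM.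
- by move=> p _; rewrite mule_ge0//; exact: b0.
- by apply: emeasurable_funM.
- by move=> p _; rewrite mule_ge0//; exact: b0.
rewrite !ge0_integralZl_EFin//.
rewrite 2!EFinD leeD2l//; apply: leeD.
  by rewrite EFinM; apply: lee_wpmul2l; [rewrite lee_fin|exact: sX].
by rewrite EFinM; apply: lee_wpmul2l; [rewrite lee_fin|apply: sX; rewrite invr_gt0].
Qed.

Lemma spread_expand X (M c : R) (F : R -> R) : measurable_fun setT X ->
  measurable_fun setT F ->
  (0 < c)%R -> (forall x y, c * `|x - y| <= `|F x - F y|)%R ->
  spread X M -> spread (F \o X) (M / c).
Proof.
move=> mX mF c0 cF [M0 sX]; split; first by rewrite divr_ge0// ltW.
move=> s s0; rewrite -mulrA [(c^-1 * s)%R]mulrC.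
apply: le_trans (sX _ (divr_gt0 s0 c0)).
apply: ge0_le_integral => //=.
- apply: (@measurable_diff (F \o X) _ _ (measurable_ball_indic s)).
  exact: measurableT_comp.
- exact: measurable_diff (measurable_ball_indic _).
- move=> p _; rewrite lee_fin !indicE ler_nat !mem_ball0; case: (ltP `|F _ - F _|%R s) => // H.
  rewrite (_ : (_ < _)%R = true)//.
  by rewrite ltr_pdivlMr// mulrC; exact: le_lt_trans (cF _ _) H.
Qed.

End diffint.

(** * Iterated squeezing *)

Section iterate.
Context {d} {T : measurableType d} {R : realType} (P : probability T R).
Variables (N : nat -> nat) (rho : nat -> R).
Hypothesis N0 : forall m, (0 < N m)%N.
Hypothesis rho12 : forall m, 0 < rho m <= 1 / 2.
Hypothesis cvgN : (fun m => (N m)%:R^-1 : R) @ \oo --> (0 : R).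
Hypothesis cvgrho : (fun m => - ln (rho m) / (N m)%:R) @ \oo --> (0 : R).
Implicit Types X : T -> R.

Let sq m := squeeze (N m)%:R (rho m).

Let N0' m : 0 < (N m)%:R :> R. Proof. by rewrite ltr0n. Qed.

(** The threshold [L] between near and far pairs is fixed first, in terms of
    [M] and [delta] only; each of the three costs is then at most [delta / 4]
    for a fine enough grid. *)
Lemma near_squeeze_energy X M delta : measurable_fun setT X -> spread P X M ->
  0 < delta -> \forall m \near \oo,
  (diffint P (sq m \o X) logker <= diffint P X logker + delta%:E)%E.
Proof.
move=> mX sX d0; have [M0 _] := sX.
have l4 : 0 <= ln 4 :> R by rewrite ln_ge0// ler1n.
pose L := delta / (4 * (ln 4 * M + 1)).
have A0 : 0 < 4 * (ln 4 * M + 1) by rewrite mulr_gt0// ltr_wpDl// mulr_ge0.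
have L0 : 0 < L by rewrite divr_gt0.
have e1 : expR (- (delta / 4)) < 1.
  by rewrite -expR0 ltr_expR oppr_lt0 divr_gt0.
have u0 : 0 < L * (1 - expR (- (delta / 4))) by rewrite mulr_gt0// subr_gt0.
have v0 : 0 < delta / (4 * (M + 1)) by rewrite divr_gt0// mulr_gt0// ltr_wpDl.
move/cvgrPdist_lt : cvgN => /(_ _ u0) nN.
move/cvgrPdist_lt : cvgrho => /(_ _ v0) nr.
near=> m.
have HN : `|0 - (N m)%:R^-1| < L * (1 - expR (- (delta / 4))) by near: m.
have Hr : `|0 - (- ln (rho m) / (N m)%:R)| < delta / (4 * (M + 1)) by near: m.
rewrite sub0r normrN gtr0_norm ?invr_gt0// in HN.
rewrite sub0r normrN in Hr.
have {}Hr := le_lt_trans (ler_norm _) Hr.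
apply: (le_trans (@diffint_squeeze _ _ _ P X M _ _ L (delta / 4) mX sX (N0' m) (rho12 m) L0 _ _)).
- by rewrite divr_ge0// ltW.
- rewrite invfM lerBrDl -lerBrDr ler_pdivrMr//.
  by rewrite mulrC ltW.
rewrite leeD2l// lee_fin.
have LA : ln 4 * (M * L) <= delta / 4.
  rewrite mulrA /L mulrA ler_pdivrMr// mulrC.
  have : 0 <= delta * ln 4 * M by rewrite mulr_ge0// mulr_ge0// ltW.
  nra.
have RA : - ln (rho m) * (M * (N m)%:R^-1) <= delta / 4.
  rewrite mulrCA mulrC; apply: (@le_trans _ _ (delta / (4 * (M + 1)) * M)).
    by rewrite ler_wpM2r// ltW.
  rewrite invfM mulrA -mulrA ler_piMr ?divr_ge0 ?ltW//.
  by rewrite mulrC ltr_pdivrMr ?mul1r ?ltrDl// ltr_wpDl.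
lra.
Unshelve. all: by end_near. Qed.

(* A quarter of the margin between a squeezed cell, of radius [rho / (2 N)], and
   the interval of radius [rho / N] around the same center: later moves, which
   sum up to at most [2 * tol], do not leave that interval. *)
Let tol m := rho m / (8 * (N m)%:R).

Let tol_gt0 m : 0 < tol m.
Proof. by have /andP[r0 _] := rho12 m; rewrite divr_gt0// mulr_gt0. Qed.

Let ok (s : (T -> R) * R) :=
  [/\ measurable_fun setT s.1, exists M, spread P s.1 M & 0 < s.2].

Let step delta (n : nat) (s : (T -> R) * R) (t : nat * ((T -> R) * R)) :=
  [/\ (n <= t.1)%N, t.2.1 = sq t.1 \o s.1, (2 * (N t.1)%:R)^-1 <= s.2,
   t.2.2 = Num.min (s.2 / 2) (tol t.1) &
   ok t.2 /\ (diffint P t.2.1 logker <= diffint P s.1 logker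
     + (delta / 2 ^+ n.+1)%:E)%E].

Let exists_step delta n s : 0 < delta -> ok s -> exists t, step delta n s t.
Proof.
move=> d0 [mX [M sX] t0].
have dn0 : 0 < delta / 2 ^+ n.+1 by rewrite divr_gt0// exprn_gt0.
have H1 := near_squeeze_energy mX sX dn0.
move/cvgrPdist_lt : cvgN => /(_ _ t0) H2.
have H3 : \forall m \near \oo, (n <= m)%N by exact: nbhs_infty_ge.
have [m [[Hm1 Hm2] Hm3]] := @filter_ex _ _ _ _ (filterI (filterI H1 H2) H3).
exists (m, (sq m \o s.1, Num.min (s.2 / 2) (tol m))); split => //=.
  apply: le_trans (ltW Hm2); rewrite sub0r normrN gtr0_norm ?invr_gt0//.
  rewrite lef_pV2 ?posrE ?mulr_gt0//.
  by rewrite ler_peMl// ler1n.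
split => //; split => /=.
- by apply: measurableT_comp => //; exact: measurable_squeeze.
- exists (M / Num.min (rho m) 4^-1).
  apply: spread_expand => //; first exact: measurable_squeeze.
    by rewrite lt_min; have /andP[-> _] := rho12 m; rewrite invr_gt0 ltr0n.
  by move=> x y; exact: squeeze_expand.
- by rewrite lt_min divr_gt0//= tol_gt0.
Qed.

(** The state of the construction is a variable [u n] together with a bound
    [tau n] on the size of the next move. Since [tau] is at least halved at each
    step, all the moves after step [n] add up to at most [2 * tau n], which
    gives both the uniform convergence and the fact that the limit stays near
    the centers visited. *)
Lemma redistribution X0 M delta : measurable_fun setT X0 -> spread P X0 M ->
  0 < delta -> exists X : T -> R, [/\ measurable_fun setT X,
    (diffint P X logker <= diffint P X0 logker + delta%:E)%E &
    forall w, 0 <= X0 w <= 1 -> forall n, exists m k,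
      [/\ (n <= m)%N, (k <= N m)%N & `|X w - k%:R / (N m)%:R| < rho m / (N m)%:R]].
Proof.
move=> mX0 sX0 d0.
have /choice[F HF] : forall ns : nat * ((T -> R) * R), exists t,
    ok ns.2 -> step delta ns.1 ns.2 t.
  move=> [n s]; have [oks|noks] := pselect (ok s).
    by have [t Ht] := exists_step n d0 oks; exists t.
  by exists (0%N, s).
pose s := fix s n := if n is n'.+1 then (F (n', s n')).2 else (X0, 1).
have oks n : ok (s n).
  elim: n => [|n IH]; first by split => //=; exists M.
  by have [_ _ _ _ []] := HF (n, s n) IH.
have st n : step delta n (s n) (F (n, s n)) by exact: HF (n, s n) (oks n).
pose u n w := (s n).1 w; pose tau n := (s n).2; pose mm n := (F (n, s n)).1.
have tau0 n : 0 < tau n by have [] := oks n.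
have uS n w : u n.+1 w = sq (mm n) (u n w).
  by have [_ E _ _ _] := st n; rewrite /u /= E.
have tauS n : tau n.+1 <= tau n / 2 /\ tau n.+1 <= tol (mm n).
  by have [_ _ _ E _] := st n; rewrite /tau /= E !ge_min !lexx orbT.
have close i j w : (j <= i)%N -> `|u i w - u j w| + 2 * tau i <= 2 * tau j.
  move/subnK <-; elim: (i - j)%N => [|n IH]; first by rewrite subrr normr0 add0r.
  rewrite addSn; have [H _] := tauS (n + j)%N.
  have mv : `|u (n + j).+1 w - u (n + j)%N w| <= tau (n + j)%N.
    rewrite uS; have [_ _ E _ _] := st (n + j)%N.
    by apply: le_trans E; apply: squeeze_move.
  have := ler_distD (u (n + j)%N w) (u (n + j).+1 w) (u j w).
  lra.
have close' i j w : (j <= i)%N -> `|u i w - u j w| <= 2 * tau j.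
  by move=> /(close _ _ w); have := tau0 i; lra.
have tau2 n : tau n <= (2^-1) ^+ n.
  elim: n => [|n IH]; first by rewrite expr0.
  by have [H _] := tauS n; rewrite exprS; lra.
have cvgu w : cvg (u ^~ w @ \oo).
  apply/cauchy_cvgP/cauchy_exP => e e0.
  have [n Hn] : exists n, 2 * tau n < e.
    have e20 : 0 < e / 2 by rewrite divr_gt0.
    by have [n Hn] := exists_half_expr e20; exists n; have := tau2 n; lra.
  exists (u n w); suff: \forall i \near \oo, ball (u n w) e (u i w) by [].
  near=> i.
  have ni : (n <= i)%N by near: i; exact: nbhs_infty_ge.
  by rewrite -ball_normE /ball_/= distrC; exact: (le_lt_trans (close' _ _ w ni) Hn).
pose X w := lim (u ^~ w @ \oo).
have Xclose w j : `|X w - u j w| <= 2 * tau j.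
  have cv : (fun i => `|u i w - u j w|) @ \oo --> `|X w - u j w|.
    by apply: cvg_norm; apply: cvgB; [exact: cvgu|exact: cvg_cst].
  rewrite -(cvg_lim _ cv)//; apply: limr_le; first by apply/cvg_ex; eexists; exact: cv.
  by near=> i; apply: close'; near: i; exact: nbhs_infty_ge.
have mu n : measurable_fun setT (u n) by have [] := oks n.
have mX : measurable_fun setT X.
  by apply: (@measurable_fun_cvg _ _ _ _ u) => // w _; exact: cvgu.
exists X; split => //.
- have E n : (diffint P (u n) logker <=
      diffint P X0 logker + (delta * (1 - 2^-1 ^+ n))%:E)%E.
    elim: n => [|n IH]; first by rewrite expr0 subrr mulr0 adde0.
    have [_ _ _ _ [_ H]] := st n.
    apply: (le_trans H); apply: (le_trans (leeD2r _ IH)).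
    rewrite -addeA -EFinD leeD2l// lee_fin -exprVn exprS; lra.
  have E' n : (diffint P (u n) logker <= diffint P X0 logker + delta%:E)%E.
    apply: (le_trans (E n)); rewrite leeD2l// lee_fin ler_piMr//; first exact: ltW.
  pose f n (p : T * T) := logker (u n p.1 - u n p.2).
  have := @fatou _ _ _ (P \x P)%E setT measurableT f _ _.
  have -> : (fun p => limn_einf (f^~ p)) = (fun p => logker (X p.1 - X p.2)).
    apply/funext => p.
    have cv : (fun n => f n p) @ \oo --> logker (X p.1 - X p.2).
      apply: (@logker_cvg _ (fun n => u n p.1 - u n p.2)).
      by apply: cvgB; exact: cvgu.
    rewrite is_cvg_limn_einfE; first exact/cvg_lim.
    by apply/cvg_ex; eexists; exact: cv.
  move=> H; apply: le_trans (H _ _) _.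
  + by move=> n; exact: (measurable_diff (mu n) (@measurable_logker R)).
  + by move=> n p _; exact: logker_ge0.
  rewrite limn_einf_lim; apply: lime_le; first exact: is_cvg_einfs.
  near=> n; apply: le_trans (E' n); apply: ereal_inf_lbound.
  by exists n => //=.
- move=> w w01 n.
  have u01 j : 0 <= u j w <= 1.
    by elim: j => [//|j IH]; rewrite uS; exact: squeeze_unit.
  have [k kN Ek] := cell_unit (N0 (mm n)) (u01 n).
  exists (mm n), k; split => //; first by have [] := st n.
  have /andP[r0 _] := rho12 (mm n).
  have := squeeze_center (u n w) (N0' (mm n)) r0.
  rewrite -/(sq (mm n) (u n w)) -uS Ek => H1.
  have H2 := Xclose w n.+1; have [_ H3] := tauS n.
  have H4 := ler_distD (u n.+1 w) (X w) (k%:R / (N (mm n))%:R).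
  have : tol (mm n) = rho (mm n) / (N (mm n))%:R / 8.
    by rewrite /tol; field; rewrite gt_eqF.
  have : rho (mm n) / (2 * (N (mm n))%:R) = rho (mm n) / (N (mm n))%:R / 2.
    by field; rewrite gt_eqF.
  have : 0 < rho (mm n) / (N (mm n))%:R by rewrite divr_gt0.
  lra.
Unshelve. all: by end_near. Qed.

End iterate.

(** * Logarithmic energy of a uniform variable *)

Section uniform01.
Context {R : realType}.
Local Open Scope ereal_scope.

Definition unif01 : probability _ R := uniform_prob (@ltr01 R).

Lemma unif01_le (f : R -> \bar R) c : measurable_fun setT f ->
  (forall v, 0 <= f v) -> (forall v, (0 <= v <= 1)%R -> f v <= c) ->
  \int[unif01]_v f v <= c.
Proof.
move=> mf f0 fc.
have c0 : 0 <= c by apply: le_trans (f0 0%R) (fc _ _); rewrite lexx ler01.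
rewrite /unif01 integral_uniform// subr0 invr1 mul1e.
apply: (@le_trans _ _ (\int[lebesgue_measure]_(x in `[0%R, 1%R]) cst c x)).
  apply: ge0_le_integral => //; first exact: measurable_funTS.
by rewrite integral_cst//= lebesgue_measure_itv/= lte_fin ltr01 oppr0 adde0 mule1.
Qed.

Lemma unif01_ball (c s : R) : (0 <= s)%R ->
  unif01 (ball c s) <= (2 * s)%:E.
Proof.
move=> s0; have mb : measurable (ball c s) := measurable_ball c s.
have mi : measurable_fun setT (fun x => (\1_(ball c s) x : R)%:E).
  exact/measurable_EFinP/measurable_indic.
rewrite -(setIT (ball c s)) -integral_indic// /unif01 integral_uniform//.
rewrite subr0 invr1 mul1e integral_indic//.
rewrite mulr_natl -(@lebesgue_measure_ball R c)//; apply: le_measure; rewrite ?inE//.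
  exact: measurableI.
Qed.

(** If [2 ^- n <= |x|] and [n] is minimal, the first [n] indicators take the
    value [1] at [x], and [- ln |x| <= n * ln 2]. This dyadic bound replaces the
    primitive of the logarithm: the kernel is integrated term by term. *)
Lemma logker_series (x : R) :
  logker x <= \sum_(k <oo) (ln 2 * \1_(ball 0%R (2^-1 ^+ k)%R) x)%:E.
Proof.
set S := (X in _ <= X).
have l2 : (0 <= ln 2 :> R)%R by rewrite ln_ge0// ler1n.
have lbS n : (forall k, (k < n)%N -> `|x| < 2^-1 ^+ k)%R -> (n%:R * ln 2)%:E <= S.
  move=> H.
  have -> : (n%:R * ln 2)%:E = \sum_(0 <= k < n) (ln 2 * \1_(ball 0%R (2^-1 ^+ k)%R) x : R)%:E.
    rewrite (eq_big_nat _ _ (F2 := fun=> (ln 2 : R)%:E)); last first.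
      by move=> k /H kn; rewrite indicE mem_ball0 kn mulr1.
    by rewrite sumEFin sumr_const_nat subn0 mulr_natl.
  by apply: nneseries_lim_ge => k _ _; rewrite lee_fin mulr_ge0.
have [x0|x0] := eqVneq x 0%R.
  have -> : S = +oo.
    apply: eq_infty => r; have [n Hn] : exists n : nat, (r <= n%:R * ln 2)%R.
      have l20 : (0 < ln 2 :> R)%R by rewrite ln_gt0// ltr1n.
      exists (Num.truncn `|r / ln 2|%R).+1; rewrite -ler_pdivrMr//.
      by apply: le_trans (ler_norm _) _; rewrite ltW// truncnS_gt.
    apply: le_trans (lbS n _); first by rewrite lee_fin.
    by move=> k _; rewrite x0 normr0 exprn_gt0// invr_gt0.
  exact: leey.
have nx0 : (0 < `|x|)%R by rewrite normr_gt0.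
have [n Pn minn] : exists2 n, (2^-1 ^+ n <= `|x|)%R &
    forall k, (k < n)%N -> (`|x| < 2^-1 ^+ k)%R.
  have ex : exists n, (2^-1 ^+ n <= `|x|)%R.
    by have [n /ltW Hn] := exists_half_expr nx0; exists n.
  exists (ex_minn ex); first by case: ex_minnP.
  case: ex_minnP => n _ H k kn; rewrite ltNge; apply: contraL kn => /H.
  by rewrite -leqNgt.
apply: le_trans (lbS n minn); rewrite logkerE// lee_fin.
rewrite -[leRHS]opprK lerN2 -mulrN -lnV ?posrE// mulr_natl -lnXn ?invr_gt0//.
rewrite ler_ln ?posrE ?exprn_gt0 ?invr_gt0//.
  rewrite le_min Pn/=; have h0 : (0 <= 2^-1 :> R)%R by rewrite invr_ge0.
  by rewrite exprn_ile1// invf_le1// ler1n.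
by rewrite lt_min nx0 ltr01.
Qed.

Lemma unif01_logker (c : R) : \int[unif01]_v logker (c - v) <= (4 * ln 2)%:E.
Proof.
have l2 : (0 <= ln 2 :> R)%R by rewrite ln_ge0// ler1n.
have ma : measurable_fun setT (fun v : R => (c - v)%R).
  by apply: measurable_funB.
have mi k : measurable_fun setT (fun v : R =>
    (ln 2 * \1_(ball 0%R (2^-1 ^+ k)%R) (c - v) : R)%:E).
  apply/measurable_EFinP; apply: measurable_funM => //.
  have mI : measurable_fun setT (\1_(ball (0%R : R) (2^-1 ^+ k)%R) : R -> R).
    by apply: measurable_indic; exact: measurable_ball.
  exact: (measurableT_comp mI ma).
have i0 k (v : R) : 0 <= (ln 2 * \1_(ball 0%R (2^-1 ^+ k)%R) (c - v) : R)%:E.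
  by rewrite lee_fin mulr_ge0.
apply: (@le_trans _ _ (\int[unif01]_v
    (\sum_(k <oo) (ln 2 * \1_(ball 0%R (2^-1 ^+ k)%R) (c - v) : R)%:E))).
  apply: ge0_le_integral => //.
  - by move=> v _; exact: logker_ge0.
  - exact: (measurableT_comp (@measurable_logker R)).
  - by apply: ge0_emeasurable_sum => k *; [exact: i0|exact: mi].
  - by move=> v _; exact: logker_series.
rewrite integral_nneseries//.
apply: (@le_trans _ _ (\sum_(k <oo) ((4 * ln 2) / (2 ^ k.+1)%:R)%:E)); last first.
  by apply: (epsilon_trick0 xpredT); rewrite mulr_ge0.
apply: lee_nneseries => // k _ ; first by move=> *; exact: integral_ge0.
have -> : (fun v : R => (ln 2 * \1_(ball 0%R (2^-1 ^+ k)%R) (c - v) : R)%:E) =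
    (fun v => (ln 2)%:E * (\1_(ball c (2^-1 ^+ k)%R) v : R)%:E).
  apply/funext => v; rewrite -EFinM; congr (_ * _)%:E; rewrite !indicE mem_ball0.
  by congr ((nat_of_bool _)%:R); apply/idP/idP; rewrite inE -ball_normE.
have mb : measurable (ball c (2^-1 ^+ k)) := measurable_ball _ _.
rewrite ge0_integralZl_EFin//; last first.
  exact/measurable_EFinP/measurable_indic.
rewrite integral_indic// setIT.
apply: (@le_trans _ _ ((ln 2)%:E * (2 * 2^-1 ^+ k)%:E)).
  apply: lee_wpmul2l; first by rewrite lee_fin.
  by apply: unif01_ball; rewrite exprn_ge0// invr_ge0.
rewrite -EFinM lee_fin exprVn natrX exprS le_eqVlt; apply/orP; left; apply/eqP.
by field; rewrite expf_neq0.
Qed.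

End uniform01.

(** * Blurring a law *)

(** For [|a| >= L] the blur, of size [eta], changes [a] by a factor close to [1].
    For smaller [a] it may increase the kernel by a constant [K], either
    pointwise if [|a| >= 4 * eta] or on average below that, thanks to
    [unif01_logker]. This constant is absorbed in a multiplicative error: the
    kernel is at least [- ln L = K / e] when [|a| < L]. A multiplicative error
    integrates to a small one as soon as the energy is finite. *)
Lemma unif01_logker_blur (R : realType) (e : R) : 0 < e -> exists2 eta : R, 0 < eta < 1 &
  forall a v : R, 0 <= v <= 1 ->
  (\int[unif01]_v' logker ((1 - eta) * a + eta * (v - v'))
    <= logker a + (e%:E * logker a + e%:E))%E.
Proof.
move=> e0.
have l2 : 0 <= ln 2 :> R by rewrite ln_ge0// ler1n.
(* [4 * ln 2] comes from [unif01_logker], and [2 * ln 2 = ln 4] from the passage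
   from [eta] to the threshold [4 * eta]. *)
pose K := 6 * ln 2 : R.
have K0 : 0 <= K by rewrite mulr_ge0.
pose L := expR (- (K / e)).
have L0 : 0 < L by rewrite expR_gt0.
have L1 : L <= 1 by rewrite -expR0 ler_expR oppr_le0 divr_ge0// ltW.
pose g := 1 - expR (- e).
have g0 : 0 < g by rewrite subr_gt0 -expR0 ltr_expR oppr_lt0.
have g1 : g < 1 by rewrite gtrBl expR_gt0.
(* Then [eta + eta / L <= g], which is what pairs with [|a| >= L] require, and
   [4 * eta <= L]. *)
pose eta := L * g / 8.
have eta0 : 0 < eta by rewrite divr_gt0// mulr_gt0.
have etaL : 8 * eta <= L by rewrite /eta mulrC divfK// ler_piMr// ltW.
have etag : 8 * eta = L * g by rewrite /eta mulrC divfK.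
exists eta; first by rewrite eta0/=; lra.
move=> a v /andP[v0 v1].
have mk : measurable_fun setT (fun v' : R => logker ((1 - eta) * a + eta * (v - v'))).
  apply: (measurableT_comp (@measurable_logker R)).
  by apply: measurable_funD => //; apply: measurable_funM => //; apply: measurable_funB.
have [a0|a0] := eqVneq a 0; first by rewrite a0 logker0 addye ?leey// gt0_muley ?lte_fin.
have la0 := logker_ge0 a.
have ela0 : (0 <= e%:E * logker a)%E by rewrite mule_ge0// lee_fin ltW.
have dist v' : 0 <= v' <= 1 -> (1 - eta) * `|a| - eta <= `|(1 - eta) * a + eta * (v - v')|.
  move=> /andP[v0' v1'].
  have -> : (1 - eta) * `|a| = `|(1 - eta) * a|.
    by rewrite normrM gtr0_norm//; lra.
  apply: le_trans (lerB_normD _ _); rewrite lerD2l lerN2.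
  by rewrite normrM gtr0_norm// ler_piMr ?(ltW eta0)// ler_norml; apply/andP; split; lra.
have Kle : `|a| < L -> (K%:E <= e%:E * logker a)%E.
  move=> aL; have := @logker_lb _ L a; rewrite L0 L1 => /(_ isT aL).
  rewrite expRK opprK => H.
  have -> : K%:E = (e%:E * (K / e)%:E)%E by rewrite -EFinM mulrCA divff ?mulr1// gt_eqF.
  by apply: lee_wpmul2l => //; rewrite lee_fin ltW.
have [aL|aL] := leP L `|a|.
  apply: unif01_le => //; first by move=> *; exact: logker_ge0.
  move=> v' /dist H.
  apply: (@le_trans _ _ (logker a + (- ln (expR (- e)))%:E)%E).
    apply: le_logker; first by rewrite expR_gt0 -expR0 ler_expR oppr_le0 ltW.
    apply: le_trans H; rewrite -[expR (- e)](subKr 1) -/g.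
    have h1 : eta <= g / 8 by rewrite /eta ler_pM2r ?ler_piMl// ltW.
    have h2 : eta <= g * `|a| / 8 by rewrite /eta ler_pM2r// mulrC ler_pM2l.
    have h3 : eta * `|a| <= g / 8 * `|a| by rewrite ler_wpM2r.
    lra.
  by rewrite expRK opprK leeD2l// leeDr.
have [ae|ae] := leP (4 * eta) `|a|.
  apply: unif01_le => //; first by move=> *; exact: logker_ge0.
  move=> v' /dist H.
  apply: (@le_trans _ _ (logker a + (- ln 2^-1)%:E)%E).
    apply: le_logker; first by lra.
    apply: le_trans H; nra.
  rewrite lnV ?posrE// opprK leeD2l//.
  apply: (@le_trans _ _ K%:E); first by rewrite lee_fin /K; lra.
  by rewrite (le_trans (Kle aL))// leeDl// lee_fin ltW.
pose c := (1 - eta) * a / eta + v.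
apply: (@le_trans _ _ (\int[unif01]_v' (logker (c - v') + (- ln eta)%:E))%E).
  apply: ge0_le_integral => //.
  - by move=> *; exact: logker_ge0.
  - apply: emeasurable_funD => //; apply: (measurableT_comp (@measurable_logker R)).
    exact: measurable_funB.
  - move=> v' _.
    have -> : (1 - eta) * a + eta * (v - v') = eta * (c - v').
      by rewrite /c; field; rewrite gt_eqF.
    apply: le_logker; first by rewrite eta0/=; lra.
    by rewrite normrM gtr0_norm.
rewrite ge0_integralD//; last 3 first.
- by move=> *; exact: logker_ge0.
- apply: (measurableT_comp (@measurable_logker R)); exact: measurable_funB.
- by move=> v' _; rewrite lee_fin oppr_ge0 ln_le0//; lra.
rewrite integral_cst// [X in (_ * X)%E](_ : _ = 1%E); last first.
  exact: (probability_setT unif01).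
rewrite mule1.
apply: (le_trans (leeD2r _ (unif01_logker c))).
have e4 : 0 < 4 * eta by rewrite mulr_gt0.
have := @logker_lb _ (4 * eta) a; rewrite e4 => /(_ _ ae) H.
have {}H : ((- ln (4 * eta))%:E <= logker a)%E by apply: H; lra.
apply: (@le_trans _ _ ((- ln (4 * eta))%:E + K%:E)%E).
  rewrite -!EFinD lee_fin lnM ?posrE// /K.
  have -> : ln 4 = 2 * ln 2 :> R.
    by rewrite mulr_natl -lnXn// -natrX.
  lra.
apply: leeD => //; apply: (le_trans (Kle aL)); rewrite leeDl// lee_fin; exact: ltW.
Qed.

Section inner.
Context {d} {T : measurableType d} {R : realType} (P : probability T R).
Local Open Scope ereal_scope.

Lemma measurable_diffint_inner (X : T -> R) (f : R -> \bar R) :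
  measurable_fun setT X -> measurable_fun setT f -> (forall x, 0 <= f x) ->
  measurable_fun setT (fun w => \int[P]_w' f (X w - X w')%R).
Proof.
move=> mX mf f0.
exact: (measurable_fun_fubini_tonelli_F (m2 := P) _ (measurable_diff mX mf)).
Qed.

End inner.

Section blur.
Context {d} {T : measurableType d} {R : realType} (P : probability T R).
Local Open Scope ereal_scope.

Definition blurP := P \x (@unif01 R).

HB.instance Definition _ := Measure.on blurP.

Let blurP_setT : blurP setT = 1.
Proof.
rewrite /blurP -setXTT product_measure1E//.
by apply: etrans (congr2 mule (probability_setT P) (probability_setT unif01)) _; exact: mule1.
Qed.

HB.instance Definition _ := @Measure_isProbability.Build _ _ R blurP blurP_setT.

(** A convex combination rather than a translation [Y + eta V], in order to
    remain in [0, 1]. *)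
Definition blur (eta : R) (Y : T -> R) (p : T * measurableTypeR R) : R :=
  ((1 - eta) * Y p.1 + eta * p.2)%R.

Lemma measurable_blur eta Y : measurable_fun setT Y -> measurable_fun setT (blur eta Y).
Proof.
move=> mY; apply: measurable_funD; apply: measurable_funM => //.
exact: (measurableT_comp mY).
Qed.

Lemma blurP_le (G : T * measurableTypeR R -> \bar R) (H : T -> \bar R) :
  measurable_fun setT G -> measurable_fun setT H -> (forall p, 0 <= G p) ->
  (forall w, \int[unif01]_v G (w, v) <= H w) ->
  \int[blurP]_p G p <= \int[P]_w H w.
Proof.
move=> mG mH G0 GH; rewrite /blurP fubini_tonelli1//.
apply: ge0_le_integral => //.
- by move=> w _; exact: integral_ge0.
- exact: measurable_fun_fubini_tonelli_F.
- by move=> w _; exact: GH.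
Qed.

Lemma blurP_le_cst (G : T * measurableTypeR R -> \bar R) (c : \bar R) :
  measurable_fun setT G -> (forall p, 0 <= G p) ->
  (forall w, \int[unif01]_v G (w, v) <= c) ->
  \int[blurP]_p G p <= c.
Proof.
move=> mG G0 Gc; rewrite -[leRHS]mule1 -(probability_setT P).
by rewrite -integral_cst//; apply: blurP_le => //.
Qed.

(** Given both copies of [Y] and the first uniform variable, the event is that
    the second uniform variable falls in an interval of length
    [2 * s / eta]. *)
Lemma spread_blur eta Y : measurable_fun setT Y -> (0 < eta < 1)%R ->
  spread blurP (blur eta Y) (2 / eta).
Proof.
move=> mY /andP[eta0 eta1]; split; first by rewrite divr_ge0// ltW.
move=> s s0; have mX := measurable_blur eta mY.
have i0 (x : R) : 0 <= (\1_(ball 0%R s) x : R)%:E by rewrite lee_fin.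
have mi := @measurable_ball_indic R s.
rewrite diffint_iter//.
have m2 := measurable_diff mX mi.
have mI := measurable_diffint_inner blurP mX mi i0.
have i2 p : 0 <= \int[blurP]_p' (\1_(ball 0%R s) (blur eta Y p - blur eta Y p')%R : R)%:E.
  exact: integral_ge0.
apply: blurP_le_cst => // w.
apply: unif01_le => //; first exact: (measurable_fun_pair2 w mI).
move=> v _; apply: blurP_le_cst => //; first exact: (measurable_fun_pair2 (w, v) m2).
move=> w' /=.
pose c := ((1 - eta) * (Y w - Y w') / eta + v)%R.
have mb : measurable (ball c (s / eta)) := measurable_ball _ _.
have -> : (fun y : R => (\1_(ball 0%R s) (blur eta Y (w, v) - blur eta Y (w', y)) : R)%:E) =
   (fun y => (\1_(ball c (s / eta)) y : R)%:E).
  apply/funext => y; rewrite !indicE mem_ball0; congr ((nat_of_bool _)%:R%:E).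
  have -> : (blur eta Y (w, v) - blur eta Y (w', y) = eta * (c - y))%R.
    by rewrite /blur /c/=; field; rewrite gt_eqF.
  rewrite normrM gtr0_norm// mulrC -ltr_pdivlMr//.
  by apply/idP/idP; rewrite inE -ball_normE.
rewrite integral_indic// setIT.
apply: le_trans (unif01_ball _ _) _; first by rewrite divr_ge0// ltW.
by rewrite lee_fin mulrA mulrAC.
Qed.

Lemma diffint_blur Y delta : measurable_fun setT Y -> (0 < delta)%R ->
  diffint P Y logker < +oo ->
  exists2 eta : R, (0 < eta < 1)%R &
   diffint blurP (blur eta Y) logker <= diffint P Y logker + delta%:E.
Proof.
move=> mY d0 Efin.
have E0 : 0 <= diffint P Y logker by apply: integral_ge0 => *; exact: logker_ge0.
set E := fine (diffint P Y logker).
have EE : diffint P Y logker = E%:E by rewrite fineK// ge0_fin_numE.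
have E0' : (0 <= E)%R by rewrite fine_ge0.
pose e := (delta / (E + 1))%R.
have e0 : (0 < e)%R by rewrite divr_gt0// ltr_wpDl.
have [eta eta01 Heta] := unif01_logker_blur e0.
exists eta => //; have mX := measurable_blur eta mY.
have mk := @measurable_logker R.
have k0 := @logker_ge0 R.
have m2 := measurable_diff mX mk.
have mY2 := measurable_diff mY mk.
have mYw w : measurable_fun setT (fun w' => logker (Y w - Y w')%R).
  exact: (measurable_fun_pair2 w mY2).
rewrite diffint_iter//.
pose H w := \int[P]_w' logker (Y w - Y w')%R.
have mH : measurable_fun setT H := measurable_diffint_inner P mY mk k0.
have H0 w : 0 <= H w by exact: integral_ge0.
have e0' : 0 <= e%:E by rewrite lee_fin ltW.
have mI := measurable_diffint_inner blurP mX mk k0.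
have i2 p : 0 <= \int[blurP]_p' logker (blur eta Y p - blur eta Y p')%R.
  exact: integral_ge0.
have lin (f : T -> \bar R) : measurable_fun setT f -> (forall w, 0 <= f w) ->
    \int[P]_w (f w + (e%:E * f w + e%:E)) =
    \int[P]_w f w + (e%:E * \int[P]_w f w + e%:E).
  move=> mf f0; have mef : measurable_fun setT (fun w => e%:E * f w).
    exact: emeasurable_funM.
  have ef0 w : 0 <= e%:E * f w by exact: mule_ge0.
  rewrite ge0_integralD//; last 2 first.
  - by move=> w _; exact: adde_ge0.
  - exact: emeasurable_funD.
  rewrite ge0_integralD// ge0_integralZl_EFin// integral_cst//.
  congr (_ + (_ + _)); rewrite -[RHS]mule1; congr (_ * _).
  exact: (probability_setT P).
apply: (@le_trans _ _ (\int[P]_w (H w + (e%:E * H w + e%:E)))).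
  apply: blurP_le => //.
    by apply: emeasurable_funD => //; apply: emeasurable_funD => //; exact: emeasurable_funM.
  move=> w; apply: unif01_le => //; first exact: (measurable_fun_pair2 w mI).
  move=> v v01 /=; rewrite /H -lin//.
  apply: blurP_le => //; first exact: (measurable_fun_pair2 (w, v) m2).
    by apply: emeasurable_funD => //; apply: emeasurable_funD => //; exact: emeasurable_funM.
  move=> w' /=.
  have -> : (fun v' => logker (blur eta Y (w, v) - blur eta Y (w', v'))%R) =
      (fun v' : R => logker ((1 - eta) * (Y w - Y w') + eta * (v - v'))%R).
    by apply/funext => v'; congr logker; rewrite /blur/=; ring.
  exact: Heta.
rewrite lin// -diffint_iter// EE leeD2l// -EFinM -EFinD lee_fin.
by rewrite /e le_eqVlt; apply/orP; left; apply/eqP; field; rewrite gt_eqF// ltr_wpDl.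
Qed.

Lemma blurP_unit (eta : R) (Y : T -> R) : measurable_fun setT Y -> (0 < eta < 1)%R ->
  P (Y @^-1` (~` `[0%R, 1%R])) = 0 ->
  blurP (blur eta Y @^-1` (~` `[0%R, 1%R])) = 0.
Proof.
move=> mY /andP[eta0 eta1] P0.
have mC : measurable (~` `[0%R, 1%R] : set R) by apply: measurableC; exact: measurable_itv.
have mA : measurable (Y @^-1` (~` `[0%R, 1%R])).
  by rewrite -[X in measurable X]setTI; exact: mY.
have mB : measurable (blur eta Y @^-1` (~` `[0%R, 1%R])).
  by rewrite -[X in measurable X]setTI; exact: (measurable_blur eta mY).
have U0 : unif01 (~` `[0%R, 1%R]) = 0 :> \bar R.
  apply/eqP; rewrite eq_le measure_ge0 andbT -[X in unif01 X]setIT -integral_indic//.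
  apply: unif01_le.
  - exact/measurable_EFinP/measurable_indic.
  - by move=> v; rewrite lee_fin.
  - by move=> v v01; rewrite indicE memNset//=; apply; rewrite in_itv.
have mV : measurable (Y @^-1` (~` `[0%R, 1%R]) `*` [set: R]) by exact: measurableX.
have mW : measurable ([set: T] `*` (~` `[0%R, 1%R] : set R)) by exact: measurableX.
pose Q : probability _ R := blurP.
apply: (subset_measure0 (mu := Q) mB (measurableU _ _ mV mW)).
  move=> [w v] /= nB; apply: contrapT => /not_orP[/= nY nv]; apply: nB.
  move/not_andP : nY => [|]; last by [].
  move=> /contrapT; rewrite in_itv/= => /andP[y0 y1].
  move/not_andP : nv => [//|/contrapT]; rewrite in_itv/= => /andP[v0 v1].
  by rewrite in_itv /blur/=; apply/andP; split; nra.
apply/eqP; rewrite eq_le measure_ge0 andbT.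
apply: (le_trans (measureU2 Q mV mW)).
rewrite -[leRHS]adde0; apply: leeD; rewrite le_eqVlt; apply/orP; left; apply/eqP.
  have E := product_measure1E P (@unif01 R) mA measurableT.
  by apply: etrans E _; rewrite [X in X * _]P0 mul0e.
have E := product_measure1E P (@unif01 R) measurableT mC.
by apply: etrans E _; rewrite [X in _ * X]U0 mule0.
Qed.

End blur.

(** * From the complex plane to the real line *)

Section borel.
Context {R : realType}.
Local Notation C := (borelC R).

Lemma Re_im_le_normc (z : R[i]) : `|complex.Re z| <= Normc.normc z /\ `|complex.Im z| <= Normc.normc z.
Proof.
case: z => a b /=; split; rewrite -sqrtr_sqr ler_sqrt ?addr_ge0 ?sqr_ge0//.
  by rewrite lerDl sqr_ge0.
by rewrite lerDr sqr_ge0.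
Qed.

Lemma measurable_lipschitz_borelC (f : R[i] -> R) :
  (forall z w : R[i], `|f z - f w| <= Normc.normc (z - w)) ->
  measurable_fun setT (f : C -> R).
Proof.
move=> f1; apply: (measurability (@RGenOpens.G R)).
  exact: RGenOpens.measurableE.
move=> _ [_ [a [b ->]] <-].
rewrite setTI; apply: sub_sigma_algebra; rewrite openE => z /=.
rewrite in_itv/= => /andP[az zb].
pose e := Num.min (f z - a) (b - f z).
have e0 : 0 < e by rewrite lt_min !subr_gt0 az zb.
apply/nbhs_ballP; exists (e%:C)%C; first by rewrite /= ltcR.
move=> w; rewrite -ball_normE /ball_/= ltcR => zw.
have := le_lt_trans (f1 z w) zw; rewrite lt_min => /andP[H1 H2].
have H3 := ler_norm (f z - f w).
have := ler_norm (- (f z - f w)); rewrite normrN => H4.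
by rewrite in_itv/=; apply/andP; split; lra.
Qed.

Lemma measurable_Re : measurable_fun setT (@complex.Re R : C -> R).
Proof.
apply: (@measurable_lipschitz_borelC (complex.Re (R:=R))) => z w.
by have [H _] := Re_im_le_normc (z - w); move: z w H => [a b] [c e].
Qed.

Lemma measurable_Im : measurable_fun setT (@complex.Im R : C -> R).
Proof.
apply: (@measurable_lipschitz_borelC (complex.Im (R:=R))) => z w.
by have [_ H] := Re_im_le_normc (z - w); move: z w H => [a b] [c e].
Qed.

Lemma measurable_real_complex : measurable_fun setT (fun x : R => (x%:C)%C : C).
Proof.
apply: (@measurability _ _ _ C setT _ (@open (R[i] : numFieldType))) => //.
move=> _ [V oV <-]; rewrite setTI; apply: open_measurable.
rewrite openE => x Vx.
move: oV; rewrite openE => /(_ _ Vx)/nbhs_ballP[e e0 eV].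
have := e0; rewrite /= ltcE /= => /andP[/eqP ie re].
apply/nbhs_ballP; exists (complex.Re e) => //.
move=> y; rewrite -ball_normE /ball_/= => xy; apply: eV.
rewrite -ball_normE /ball_/= -rmorphB/= normc_def/= expr0n/= addr0 sqrtr_sqr.
by move: re ie xy e0; case: (e) => er ei /= _ -> xy _; rewrite ltcR.
Qed.


Lemma embCE (A : set R) : embC A =
  (complex.Re (R:=R) @^-1` A) `&` (complex.Im (R:=R) @^-1` [set 0]).
Proof.
apply/seteqP; split=> [_ [x Ax <-]//|[a b] /= [Aa b0]].
by exists a => //; rewrite b0.
Qed.

Lemma measurable_embC (A : set R) : measurable A -> measurable (embC A : set C).
Proof.
move=> mA; rewrite embCE; apply: measurableI.
  by rewrite -[X in measurable X]setTI; exact: measurable_Re.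
by rewrite -[X in measurable X]setTI; exact: measurable_Im.
Qed.

Definition Ckernel (p : C * C) : \bar R :=
  (- lne (Normc.normc ((p.1 : R[i]) - (p.2 : R[i])))%:E)%E.

Lemma measurable_Ckernel : measurable_fun setT Ckernel.
Proof.
pose D (f : C -> R) := fun p : C * C => f p.1 - f p.2.
have mD f : measurable_fun setT f -> measurable_fun setT (D f).
  by move=> mf; apply: measurable_funB; exact: (measurableT_comp mf).
pose n p := Num.sqrt (D (complex.Re (R:=R)) p ^+ 2 + D (complex.Im (R:=R)) p ^+ 2).
have mn : measurable_fun setT n.
  have ms : measurable_fun setT (@Num.sqrt R).
    by apply: continuous_measurable_fun; exact: sqrt_continuous.
  apply: (measurableT_comp ms).
  apply: measurable_funD; apply: measurable_funX; apply: mD.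
    exact: measurable_Re.
  exact: measurable_Im.
have -> : Ckernel = fun p => if n p <= 0 then +oo%E else (- ln (n p))%:E.
  apply/funext => -[[a b] [c e]]; rewrite /Ckernel /n /D /=.
  by case: ifPn.
apply: measurable_fun_ifT => //.
  exact: measurable_fun_ler.
apply/measurable_EFinP; apply/measurable_funN.
by apply: measurableT_comp => //; exact: measurable_ln.
Qed.

Lemma Ckernel_logker (z w : R[i]) : embC `[0, 1] z -> embC `[0, 1] w ->
  Ckernel (z, w) = logker (complex.Re z - complex.Re w).
Proof.
move=> [x]; rewrite /= in_itv/= => /andP[x0 x1] <- [y]; rewrite /= in_itv/= => /andP[y0 y1] <-.
rewrite /Ckernel /logker /= subr0 expr0n/= addr0 sqrtr_sqr min_l//.
by rewrite ler_norml; apply/andP; split; lra.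
Qed.

Local Open Scope ereal_scope.

(** Both kernels agree on [embC [0, 1]] only, so the comparison is almost
    everywhere, and it requires the measurability of the inner integral of
    a kernel of variable sign, which is a difference of two nonnegative
    integrals. *)
Lemma energyE (mu : probability C R) : mu (~` (embC `[0%R, 1%R] : set C)) = 0 ->
  energy mu = diffint mu (@complex.Re R) logker.
Proof.
move=> mu0; have mE : measurable (embC `[0%R, 1%R] : set C).
  by apply: measurable_embC; exact: measurable_itv.
have mk := measurable_diff measurable_Re (@measurable_logker R).
have mKz z : measurable_fun setT (fun w => Ckernel (z, w)).
  exact: (measurable_fun_pair2 z measurable_Ckernel).
have mpos := measurable_funepos measurable_Ckernel.
have mneg := measurable_funeneg measurable_Ckernel.
have mI : measurable_fun setT (fun z => \int[mu]_w Ckernel (z, w)).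
  have -> : (fun z => \int[mu]_w (Ckernel (z, w))) =
      (fun z => fubini_F mu Ckernel^\+ z - fubini_F mu Ckernel^\- z).
    apply/funext => z; rewrite integralE; congr (_ - _); apply: eq_integral => w _.
      by rewrite !funeposE.
    by rewrite !funenegE.
  apply: emeasurable_funB.
    exact: (measurable_fun_fubini_tonelli_F _ mpos (funepos_ge0 _)).
  exact: (measurable_fun_fubini_tonelli_F _ mneg (funeneg_ge0 _)).
rewrite diffint_iter; [|exact: measurable_Re|exact: measurable_logker|exact: logker_ge0].
have nE : mu.-negligible (~` (embC `[0%R, 1%R] : set C)).
  by exists (~` (embC `[0%R, 1%R] : set C)); split => //; exact: measurableC.
apply: ae_eq_integral => //.
- exact: (measurable_diffint_inner mu measurable_Re (@measurable_logker R) (@logker_ge0 R)).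
apply: (negligibleS _ nE) => z /= nz Ez; apply: nz => _.
apply: ae_eq_integral => //.
- exact: mKz.
- exact: (measurable_fun_pair2 z mk).
by apply: (negligibleS _ nE) => w /= nw Ew; apply: nw => _; exact: Ckernel_logker.
Qed.

Lemma law_energy d (T : measurableType d) (P : probability T R) (X : T -> R)
    (S : set R) : measurable S -> S `<=` `[0%R, 1%R] -> measurable_fun setT X ->
  P (X @^-1` (~` S)) = 0 ->
  exists2 nu, prob_on (embC S) nu & energy nu = diffint P X logker.
Proof.
move=> mS S01 mX P0.
have mXC : measurable_fun setT (fun w => (X w)%:C%C : C).
  exact: (measurableT_comp measurable_real_complex mX).
pose XC : {mfun T >-> C} := HB.pack (fun w => (X w)%:C%C : C) (isMeasurableFun.Build _ _ _ _ _ mXC).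
pose nu : probability C R := distribution P XC.
have nuS : prob_on (embC S) nu.
  rewrite /prob_on /= /distribution /pushforward -[RHS]P0; congr (P _).
  apply/seteqP; split=> w /=; apply: contra_not.
    by move=> Sx; exists (X w).
  by move=> [x Sx] [<-].
exists nu => //.
have mS01 : nu (~` (embC `[0%R, 1%R] : set C)) = 0.
  apply/eqP; rewrite eq_le measure_ge0 andbT -nuS; apply: le_measure; rewrite ?inE.
  - by apply: measurableC; apply: measurable_embC; exact: measurable_itv.
  - by apply: measurableC; exact: measurable_embC.
  - by apply: subsetC => _ [x Sx <-]; exists x => //; exact: S01.
rewrite energyE// diffint_iter; [|exact: measurable_Re|exact: measurable_logker|exact: logker_ge0].
rewrite [RHS]diffint_iter; [|exact: mX|exact: measurable_logker|exact: logker_ge0].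
have mI := measurable_diffint_inner nu measurable_Re (@measurable_logker R) (@logker_ge0 R).
have mk := measurable_diff measurable_Re (@measurable_logker R).
rewrite [LHS]ge0_integral_pushforward//; last first.
  by move=> z _; apply: integral_ge0 => w _; exact: logker_ge0.
apply: eq_integral => w _ /=.
rewrite [LHS]ge0_integral_pushforward//.
  exact: (measurable_fun_pair2 (XC w) mk).
by move=> z _; exact: logker_ge0.
Qed.

Lemma Cap_embC (S : set R) : measurable S -> S `<=` `[0%R, 1%R] ->
  (forall mu delta, prob_on (embC `[0%R, 1%R]) mu -> energy mu < +oo -> (0 < delta)%R ->
    exists2 nu, prob_on (embC S) nu & energy nu <= energy mu + delta%:E) ->
  Cap (embC S) = Cap (embC `[0%R, 1%R]).
Proof.
move=> mS S01 H; rewrite /Cap; congr (expeR (- _)).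
apply/eqP; rewrite eq_le; apply/andP; split.
  apply: le_ereal_inf_tmp => _ [mu mu01 <-].
  have [fin|] := ltP (energy mu) +oo; last by rewrite leye_eq => /eqP ->; exact: leey.
  apply/lee_addgt0Pr => delta d0.
  have [nu nuS le] := H mu delta mu01 fin d0.
  by apply: le_trans le; apply: ereal_inf_lbound; exists nu.
apply: ereal_inf_le_tmp => _ [nu nuS <-]; exists nu => //.
rewrite /prob_on/=.
apply/eqP; rewrite eq_le measure_ge0 andbT -nuS; apply: le_measure; rewrite ?inE.
- by apply: measurableC; apply: measurable_embC; exact: measurable_itv.
- by apply: measurableC; exact: measurable_embC.
- by apply: subsetC => _ [x Sx <-]; exists x => //; exact: S01.
Qed.

End borel.

(** * Choice of the scales *)

Lemma not_bigO_small (R : realType) (h : R -> R) (k eta : R) :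
  ~ ((fun r => 1 / `|ln r|) =O_ (0^'+) h) -> 0 < k -> 0 < eta ->
  exists2 r, 0 < r < eta & k * `|h r| < 1 / `|ln r|.
Proof.
move=> nO k0 eta0; apply: contrapT => H; apply: nO; apply/eqO_exP.
exists k => //; near=> r.
rewrite leNgt [`|1 / _|]ger0_norm; last by rewrite divr_ge0.
apply/negP => Hr; apply: H; exists r => //; apply/andP; split.
  by near: r; exact: nbhs_right_gt.
by near: r; exact: nbhs_right_lt.
Unshelve. all: by end_near. Qed.

(** With [l = |ln r|], [N] is the least power of [2] above [2 ^ m * l], so that
    [N <= 2 ^ m.+1 * l]. The lower bound makes [|ln r| / N] small. By the upper
    bound [(N + 1) * h r] is at most [4 * 2 ^ m * (l * h r)], and the failure of
    the big-O makes [l * h r] smaller than [1 / (4 * 8 ^ m)]. Finally [r * N] is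
    small because [r * |ln r| <= 2 * sqrt r]. *)
Lemma exists_scale (R : realType) (h : R -> R) (rstar : R) (m : nat) :
  0 < rstar -> (forall r, 0 < r < rstar -> 0 < h r) ->
  ~ ((fun r => 1 / `|ln r|) =O_ (0^'+) h) ->
  exists r : R, exists a : nat, let N : R := 2 ^+ a in
    [/\ 0 < r < rstar /\ r <= 2^-1 ^+ m, (m <= a)%N,
        r * N <= 1,
        - ln (r * N / 2) / N <= 2 * 2^-1 ^+ m &
        (N + 1) * h r <= 4^-1 ^+ m].
Proof.
move=> rs0 h0 nO.
have two0 n : 0 < 2 ^+ n :> R by rewrite exprn_gt0.
(* If [sqrt r < s0] then [r * N <= 2 ^ m.+1 * (r * l) <= 2 ^ m.+2 * s0 = 1]. *)
pose s0 : R := 2^-1 ^+ m.+2.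
have s00 : 0 < s0 by rewrite exprn_gt0// invr_gt0.
pose eta := Num.min rstar (Num.min (expR (-1)) (s0 ^+ 2)).
have eta0 : 0 < eta by rewrite !lt_min rs0 expR_gt0 exprn_gt0.
have k0 : 0 < 4 * 8 ^+ m :> R by rewrite mulr_gt0// exprn_gt0.
have [r /andP[r0 reta] hr] := not_bigO_small nO k0 eta0.
move: reta; rewrite !lt_min => /and3P[rrs re rs].
have hr0 : 0 < h r by apply: h0; rewrite r0.
pose l := - ln r.
have l1 : 1 <= l by rewrite lerNr -(expRK (-1)) ler_ln ?posrE ?expR_gt0// ltW.
have lE : `|ln r| = l by rewrite ltr0_norm//; rewrite /l in l1; lra.
rewrite lE gtr0_norm// in hr.
pose s := Num.sqrt r.
have s1 : 0 < s by rewrite sqrtr_gt0.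
have sr : s ^+ 2 = r by rewrite sqr_sqrtr// ltW.
have ss0 : s < s0 by rewrite -(@ltr_pXn2r _ 2)// ?nnegrE ?ltW// sr.
have rl : r * l <= 2 * s.
  have : ln s^-1 < s^-1 by apply: ln_sublinear; rewrite invr_gt0.
  rewrite lnV ?posrE// => lns.
  rewrite /l -sr lnXn// mulr2n.
  have : s * - ln s < 1 by rewrite mulrC -ltr_pdivlMr// div1r.
  nra.
have ex : exists a, 2 ^+ m * l <= 2 ^+ a.
  exists (Num.truncn (2 ^+ m * l)).+1; apply: (le_trans (ltW (truncnS_gt _))).
  by rewrite -(natrX R 2 _.+1) ler_nat ltnW// ltn_expl.
pose a := ex_minn ex.
have [aL aU] : 2 ^+ m * l <= 2 ^+ a /\ (2 : R) ^+ a <= 2 * (2 ^+ m * l).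
  rewrite /a; case: ex_minnP => -[|b] H1 H2; split => //.
    have : 1 <= 2 ^+ m :> R by rewrite exprn_ege1// ler1n.
    rewrite expr0; nra.
  rewrite exprS ler_pM2l// leNgt; apply/negP => /ltW/H2.
  by rewrite ltnn.
clearbody a; clear ex.
exists r, a => N.
have N0 : 0 < N by exact: two0.
have ma : (m <= a)%N.
  rewrite -(@ler_eXn2l _ (2 : R)) ?ltr1n//; apply: le_trans aL.
  by rewrite ler_peMr// ltW.
have N1 : 1 <= N by rewrite exprn_ege1// ler1n.
have s0E : 2 ^+ m * s0 = 4^-1.
  rewrite /s0 exprS exprS exprVn; field; rewrite gt_eqF//.
split => //.
- split; first by rewrite r0.
  rewrite -sr; apply: (@le_trans _ _ (s0 ^+ 2)); first by rewrite ler_pXn2r ?nnegrE ?ltW.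
  rewrite /s0 -exprM; apply: ler_wiXn2l; first by rewrite invr_ge0.
    by rewrite invf_le1// ler1n.
  by apply: (@leq_trans m.+2); [do 2 apply: leqW|exact: leq_pmulr].
- have : r * N <= r * (2 * (2 ^+ m * l)) by rewrite ler_pM2l.
  have -> : r * (2 * (2 ^+ m * l)) = 2 * 2 ^+ m * (r * l) by ring.
  move=> H; apply: (le_trans H).
  have : 2 * 2 ^+ m * (r * l) <= 2 * 2 ^+ m * (2 * s0).
    by rewrite ler_pM2l ?mulr_gt0// (le_trans rl)// ler_pM2l// ltW.
  move=> H2; apply: (le_trans H2).
  have -> : 2 * 2 ^+ m * (2 * s0) = 4 * (2 ^+ m * s0) by ring.
  by rewrite s0E divff.
- rewrite ler_pdivrMr// lnM ?posrE ?mulr_gt0 ?invr_gt0// lnV ?posrE// lnM ?posrE//.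
  have lN : 0 <= ln N by exact: ln_ge0.
  have l2' : ln 2 <= 1 :> R.
    by apply: (@le_ln1Dx R 1); lra.
  have : 2^-1 ^+ m * (2 ^+ m * l) <= 2^-1 ^+ m * N by rewrite ler_pM2l// exprn_gt0// invr_gt0.
  rewrite mulrA exprVn mulVf ?gt_eqF// mul1r => H.
  rewrite -mulrA.
  move: l1 H lN l2'; rewrite /l.
  by move: (ln r) (ln N) (ln 2) (2 ^- m * N) => A B D E; lra.
- move: hr; rewrite ltr_pdivlMr; last by lra.
  move=> hr.
  have : (N + 1) * h r <= (2 * (2 * (2 ^+ m * l))) * h r.
    rewrite ler_pM2r//; have aU' : N <= 2 * (2 ^+ m * l) := aU.
    by move: N1 aU'; move: (N) (2 ^+ m * l) => A B; lra.
  move=> H; apply: (le_trans H).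
  have -> : 2 * (2 * (2 ^+ m * l)) * h r = 4 * 8 ^+ m * h r * l * (4^-1 ^+ m).
    have -> : 8 ^+ m = 4 ^+ m * 2 ^+ m :> R by rewrite -exprMn -natrM.
    have B0 : 4 ^+ m != 0 :> R by rewrite expf_neq0.
    by rewrite exprVn; move: (2 ^+ m) (4 ^+ m) B0 => A B B0; field.
  by rewrite ler_piMl ?exprn_ge0 ?invr_ge0// ltW.
Qed.

(** * The set *)

Section limsup_grid.
Context {R : realType}.
Variables (r : nat -> R) (a : nat -> nat).
Implicit Types x : R.

Definition grid_nbhs m : set R :=
  \bigcup_(k in [set k | (k <= 2 ^ a m)%N]) ball (k%:R / 2 ^+ a m : R) (r m / 2).

Definition limsup_grid : set R :=
  \bigcap_n \bigcup_(m in [set m | (n <= m)%N]) grid_nbhs m.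

Lemma limsup_grid_Gdelta : Gdelta limsup_grid.
Proof.
exists (fun n => \bigcup_(m in [set m | (n <= m)%N]) grid_nbhs m) => // n.
by apply: bigcup_open => m _; apply: bigcup_open => k _; exact: ball_open.
Qed.

Hypothesis r_gt0 : forall m, 0 < r m.
Hypothesis r_small : forall m, r m <= 2^-1 ^+ m.
Hypothesis a_ge : forall m, (m <= a m)%N.

Lemma limsup_grid_unit : limsup_grid `<=` `[0, 1].
Proof.
move=> x Sx; rewrite /= in_itv/=.
have near e : 0 < e -> - e <= x <= 1 + e.
  move=> e0; have [n Hn] := exists_half_expr e0.
  have [m /= nm [k /= kN]] := Sx n I; rewrite -ball_normE /ball_/=.
  have N0 : 0 < 2 ^+ a m :> R by rewrite exprn_gt0.
  have k0 : 0 <= k%:R / 2 ^+ a m :> R by rewrite divr_ge0// ltW.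
  have k1 : k%:R / 2 ^+ a m <= 1 :> R.
    by rewrite ler_pdivrMr// mul1r -natrX ler_nat.
  move: (k%:R / _) k0 k1 => c c0 c1; rewrite ltr_norml => /andP[H1 H2].
  have := r_small m; have := @half_expr_le R _ _ nm; have := r_gt0 m.
  by move: (r m) (2^-1 ^+ m) H1 H2 => s p *; apply/andP; split; lra.
apply/andP; split.
  apply/ler_addgt0Pr => e e0; have /andP[H _] := near e e0.
  by rewrite -lerBlDr sub0r.
by apply/ler_addgt0Pr => e e0; have /andP[_ ->] := near e e0.
Qed.

(** A dyadic point is a center at every level that refines its own. *)
Lemma limsup_grid_dyadic (k b : nat) : (k <= 2 ^ b)%N -> limsup_grid (k%:R / 2 ^+ b).
Proof.
move=> kb n _; exists (maxn n b); first exact: leq_maxl.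
set m := maxn n b.
have bm : (b <= a m)%N by apply: leq_trans (a_ge m); exact: leq_maxr.
exists (k * 2 ^ (a m - b))%N; rewrite /=.
  by rewrite -[X in (_ <= 2 ^ X)%N](subnKC bm) expnD leq_mul2r kb orbT.
have -> : (k * 2 ^ (a m - b))%N%:R / 2 ^+ a m = k%:R / 2 ^+ b :> R.
  rewrite -[in 2 ^+ a m](subnKC bm) natrM natrX exprD.
  by field; rewrite !expf_neq0.
by apply: ballxx; rewrite divr_gt0.
Qed.

Lemma limsup_grid_dense : `[0, 1] `<=` closure limsup_grid.
Proof.
move=> x; rewrite /= in_itv/= => x01 B /nbhs_ballP[e /= e0 eB].
have [b Hb] := exists_half_expr e0.
have [k kb kE] := cell_unit (n := 2 ^ b) (expn_gt0 2 b) x01.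
exists (k%:R / 2 ^+ b); split; first exact: limsup_grid_dyadic.
apply: eB; rewrite -ball_normE /ball_/=; apply: le_lt_trans Hb.
have /andP[H1 H2] := cell_itv (2 ^ b)%:R x.
have N0 : 0 < 2 ^+ b :> R by rewrite exprn_gt0.
rewrite kE natrX in H1 H2.
have -> : x - k%:R / 2 ^+ b = (2 ^+ b * x - k%:R) / 2 ^+ b.
  by field; rewrite gt_eqF.
rewrite normrM [`|_^-1|]gtr0_norm ?invr_gt0// exprVn ler_piMl//.
by rewrite ler_norml; apply/andP; split; lra.
Qed.

Variables (h : R -> R) (rstar : R).
Hypothesis rstar_gt0 : 0 < rstar.
Hypothesis h_gt0 : forall s, 0 < s < rstar -> 0 < h s.
Hypothesis r_lt : forall m, r m < rstar.
Hypothesis hr_small : forall m, (2 ^+ a m + 1) * h (r m) <= 4^-1 ^+ m.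

Let h_content_ge0 (E : set R) eps : eps < rstar -> (0 <= h_content h E eps)%E.
Proof.
move=> er; apply: le_ereal_inf_tmp => _ [D [x [s [[Ds _] ->]]]].
apply: esum_ge0 => j /Ds /andP[s0 se]; rewrite lee_fin ltW// h_gt0// s0/=.
exact: lt_trans se er.
Qed.

(* The pairs (level, center) of the cover are numbered by [pickle], since covers
   are indexed by natural numbers. *)
Let h_content_limsup_grid eps : 0 < eps -> eps < rstar -> h_content h limsup_grid eps = 0%E.
Proof.
move=> eps0 er; apply/eqP; rewrite eq_le h_content_ge0// andbT.
apply/lee_addgt0Pr => delta d0; rewrite add0e.
have u0 : 0 < Num.min eps (delta / 2) by rewrite lt_min eps0 divr_gt0.
have [n] := exists_half_expr u0; rewrite lt_min => /andP[ne nd].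
pose M := [set m | (n <= m)%N].
pose J (m : nat) : set nat := `I_(2 ^ a m).+1.
pose dec (j : nat) : nat * nat := odflt (0%N, 0%N) (choice.unpickle j).
have decK p : dec (choice.pickle p) = p by rewrite /dec choice.pickleK.
have hr0 m : 0 <= h (r m) by rewrite ltW// h_gt0// r_gt0 r_lt.
apply: ge_ereal_inf; eexists; first exists (choice.pickle @` (M `*`` J)),
    (fun j => (dec j).2%:R / 2 ^+ a (dec j).1), (fun j => r (dec j).1).
  split; last reflexivity.
  split.
    move=> _ [[m k] [/= nm _] <-]; rewrite decK r_gt0/=.
    apply: le_lt_trans ne; apply: (le_trans (r_small m)); exact: half_expr_le.
  move=> x /(_ n I) [m /= nm [k /= kN xk]].
  exists (choice.pickle (m, k)); first by exists (m, k).
  by rewrite decK.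
rewrite (@esum_image R _ _ _ choice.pickle (fun j => (h (r (dec j).1))%:E)); last first.
  by move=> p q _ _; exact: (pcan_inj choice.pickleK).
under eq_esum do rewrite decK.
(* The cost of level [m] is at most [4 ^- m <= 2 ^- n * 2 ^- m], hence at most
   [delta / 2 ^ m.+1] by the choice of [n]. *)
rewrite -(@esum_esum R _ _ M J (fun m _ => (h (r m))%:E)); last first.
  by move=> *; rewrite lee_fin.
apply: (@le_trans _ _ (\esum_(m in M) (delta / (2 ^ m.+1)%:R)%:E)%E).
  apply: le_esum => m nm.
  have -> : (\esum_(k in J m) (h (r m))%:E = ((2 ^+ a m + 1) * h (r m))%:E)%E.
    rewrite esum_fset; [|exact: finite_II|by move=> *; rewrite lee_fin].
    rewrite /J -fsbig_ord sumEFin sumr_const card_ord.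
    by rewrite -[X in X%:E = _]mulr_natl -natr1 natrX.
  rewrite lee_fin; apply: (le_trans (hr_small m)).
  rewrite natrX exprS invfM mulrA.
  have -> : 4^-1 ^+ m = 2^-1 ^+ m * 2^-1 ^+ m :> R.
    by rewrite -exprMn -invfM -natrM.
  rewrite -exprVn ler_pM2r ?exprn_gt0 ?invr_gt0//.
  by apply: le_trans (ltW nd); exact: half_expr_le.
rewrite -(@nneseries_esum R (fun m => (delta / (2 ^ m.+1)%:R)%:E) (fun m => (n <= m)%N)).
  by apply: epsilon_trick0; exact: ltW.
by move=> m _; rewrite lee_fin divr_ge0// ltW.
Qed.

Lemma h_volume_limsup_grid : h_volume h limsup_grid = 0%E.
Proof.
apply/cvg_lim => //; apply: cvg_near_cst; near=> eps.
by apply: h_content_limsup_grid; near: eps; [exact: nbhs_right_gt|exact: nbhs_right_lt].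
Unshelve. all: by end_near. Qed.

End limsup_grid.

(** * The theorem *)

Unset Implicit Arguments.

Theorem theorem1p5 (R : realType) (h : R -> R)
    (h_measuring : measuring_function h)
    (h_not_bigO : ~ ((fun r => 1 / `|ln r|) =O_ (0^'+) h)) :
  exists S : set R,
    [/\ S `<=` `[0, 1],
        `[0, 1] `<=` closure S,
        Gdelta S,
        h_volume h S = 0%E &
        Cap (embC S) = Cap (embC `[0, 1])].
Proof.
have [rstar rs0 [h_pos _ _]] := h_measuring.
have h0 s : 0 < s < rstar -> 0 < h s by move=> s0; apply: h_pos; rewrite in_itv.
have /choice[r /choice[a H]] := fun m => exists_scale m rs0 h0 h_not_bigO.
have r0 m : 0 < r m by have [[/andP[]]] := H m.
have rlt m : r m < rstar by have [[/andP[]]] := H m.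
have rsm m : r m <= 2^-1 ^+ m by have [[]] := H m.
have am m : (m <= a m)%N by have [] := H m.
have rN m : r m * 2 ^+ a m <= 1 by have [] := H m.
have lnr m : - ln (r m * 2 ^+ a m / 2) / 2 ^+ a m <= 2 * 2^-1 ^+ m by have [] := H m.
have hr m : (2 ^+ a m + 1) * h (r m) <= 4^-1 ^+ m by have [] := H m.
have S01 := limsup_grid_unit r0 rsm (a := a).
exists (limsup_grid r a); split => //.
- exact: limsup_grid_dense.
- exact: limsup_grid_Gdelta.
- exact: (h_volume_limsup_grid r0 rsm rs0).
have mS : measurable (limsup_grid r a).
  by apply: Gdelta_measurable; exact: limsup_grid_Gdelta.
apply: Cap_embC => // mu delta mu01 fin d0.
have d20 : 0 < delta / 2 by rewrite divr_gt0.
have EE := energyE mu01; rewrite EE in fin *.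
have [eta eta01 Eeta] := diffint_blur (@measurable_Re R) d20 fin.
pose P : probability _ R := blurP mu.
pose N m := (2 ^ a m)%N; pose rho m := r m * (N m)%:R / 2.
have NE m : (N m)%:R = 2 ^+ a m :> R by rewrite natrX.
have N0 m : (0 < N m)%N by rewrite expn_gt0.
have N0' m : 0 < (N m)%:R :> R by rewrite ltr0n.
have rho12 m : 0 < rho m <= 1 / 2.
  rewrite divr_gt0 ?mulr_gt0//= ler_pM2r// NE; exact: rN.
have cvgN : (fun m => (N m)%:R^-1 : R) @ \oo --> (0 : R).
  apply: (@squeeze_cvgr _ _ _ _ (fun=> 0) (fun n => 2^-1 ^+ n)); [|exact: cvg_cst|exact: cvg_half_expr].
  apply: nearW => m; rewrite invr_ge0 ltW//= NE -exprVn.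
  exact: half_expr_le.
have cvgrho : (fun m => - ln (rho m) / (N m)%:R) @ \oo --> (0 : R).
  apply: (@squeeze_cvgr _ _ _ _ (fun=> 0) (fun n => 2 * 2^-1 ^+ n)).
  - apply: nearW => m; apply/andP; split.
      rewrite divr_ge0// oppr_ge0 ln_le0//.
      by have /andP[_ H1] := rho12 m; lra.
    by rewrite /rho !NE.
  - exact: cvg_cst.
  - by rewrite -[X in _ --> X](mulr0 2); apply: cvgM; [exact: cvg_cst|exact: cvg_half_expr].
pose X0 := blur eta (@complex.Re R : borelC R -> R).
have mX0 : measurable_fun setT X0 := measurable_blur eta (@measurable_Re R).
have [X [mX EX XS]] := redistribution N0 rho12 cvgN cvgrho mX0
  (spread_blur mu (@measurable_Re R) eta01) d20.
have X_S w : 0 <= X0 w <= 1 -> limsup_grid r a (X w).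
  move=> w01 n _; have [m [k [nm kN Xk]]] := XS w w01 n.
  exists m => //; exists k => //; rewrite -ball_normE /ball_/= distrC.
  move: Xk; rewrite NE => Xk; apply: lt_le_trans Xk _.
  rewrite /rho NE le_eqVlt; apply/orP; left; apply/eqP.
  by field; rewrite expf_neq0.
have [nu nuS nuE] : exists2 nu, prob_on (embC (limsup_grid r a)) nu &
    energy nu = diffint P X logker.
  apply: law_energy => //.
  have m01 : measurable (~` `[0, 1] : set R).
    by apply: measurableC; exact: measurable_itv.
  have mY : measurable (X0 @^-1` (~` `[0, 1])).
    by rewrite -[X in measurable X]setTI; exact: mX0.
  have mXS : measurable (X @^-1` (~` limsup_grid r a)).
    by rewrite -[X in measurable X]setTI; apply: mX => //; exact: measurableC.
  apply: (subset_measure0 (mu := P) mXS mY).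
    by move=> w /=; apply: contra_not; rewrite in_itv; exact: X_S.
  apply: blurP_unit => //; first exact: measurable_Re.
  have mR : measurable (@complex.Re R @^-1` (~` `[0, 1]) : set (borelC R)).
    by rewrite -[X in measurable X]setTI; exact: measurable_Re.
  have mE : measurable (~` (embC `[0, 1] : set (borelC R))).
    by apply: measurableC; apply: measurable_embC; exact: measurable_itv.
  apply: (subset_measure0 (mu := mu) mR mE) => //.
  by move=> z /=; apply: contra_not => -[x x01 <-].
exists nu => //; rewrite nuE; apply: (le_trans EX).
apply: (le_trans (leeD2r _ Eeta)).
by rewrite -addeA -EFinD leeD2l// lee_fin; lra.
Qed.
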